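(* The generating function of the even dimensional Clifford-Fourier kernels is \[ G_{\pi/2}(x,y,a)=\begin{pmatrix}0&1\end{pmatrix}e^{-A}\begin{pmatrix}1\\1\end{pmatrix} =\cos\!\Big(\sqrt{|x|^{2}|y|^{2}-((x,y)-a)^{2}}\Big)+\big(-yx-(x,y)+a\big)\frac{\sin\!\Big(\sqrt{|x|^{2}|y|^{2}-((x,y)-a)^{2}}\Big)}{\sqrt{|x|^{2}|y|^{2}-((x,y)-a)^{2}}}, \] where \[ A=(a-(x,y))\begin{pmatrix}1&0\\0&-1\end{pmatrix}+\begin{pmatrix}0&-xy\\ yx&0\end{pmatrix}. \]
   Context: Let $\mathcal{C}\ell_{0,m}$ be the Clifford algebra generated by an orthonormal basis $e_1,\dots,e_m$ of $\mathbb{R}^m$ with $e_ie_j+e_je_i=-2\delta_{ij}$; vectors $x=\sum_j x_je_j$, $y=\sum_j y_je_j$ are embedded in it, $xy$ and $yx$ denote Clifford products, $(x,y)=\sum_j x_jy_j=-\tfrac12(xy+yx)$ is the Euclidean inner product, $x\wedge y=\tfrac12(xy-yx)$, and $|x|$ is the Euclidean norm. Let $\Gamma_y=-\sum_{j<k}e_je_k(y_j\partial_{y_k}-y_k\partial_{y_j})$. The fractional Clifford-Fourier kernel is $K_m^p(x,y)=e^{ip\Gamma_y}e^{-i(x,y)}$, and the Clifford-Fourier kernel is $K_m(x,y)=K_m^{\pi/2}(x,y)$. The formal generating function for the even dimensional kernels is $G_{\pi/2}(x,y,a)=\sum_{m=2,4,6,\dots}\frac{K_m(x,y)\,a^{m/2-1}}{\Gamma(m/2)}$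 (formal in the sense that the kernels are recovered from derivatives in $a$; each kernel is regarded as a function of $(x,y)$, $|x||y|$ and $|x\wedge y|$, with $x\wedge y/|x\wedge y|$ acting as an imaginary unit). *)

(* Defs.v *)
From Stdlib Require Import Reals.
From Coquelicot Require Import Coquelicot.
From mathcomp Require Import ssreflect ssrfun ssrbool eqtype ssrnat seq choice fintype finset bigop.

Set Implicit Arguments.
Unset Strict Implicit.
Unset Printing Implicit Defensive.

Local Open Scope R_scope.

(** * The Clifford algebra Cl_{0,m}
    An element is given by its coordinates on the basis blades e_A,
    A a subset of {0,..,m-1} (e_A = e_{a1}...e_{ar}, a1 < ... < ar). *)
Definition Cl (m : nat) := {set 'I_m} -> R.

Definition cl0 {m} : Cl m := fun _ => 0.
Definition cl1 {m} : Cl m := fun A => if A == set0 then 1 else 0.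
Definition cladd {m} (u v : Cl m) : Cl m := fun A => u A + v A.
Definition clscal {m} (r : R) (u : Cl m) : Cl m := fun A => r * u A.
Definition clopp {m} (u : Cl m) : Cl m := fun A => - u A.

(** e_A e_B = blade_sign A B * e_(A symmetric-difference B), encoding
    e_i e_j + e_j e_i = -2 delta_ij. *)
Definition blade_sign {m} (A B : {set 'I_m}) : R :=
  (-1) ^ (#|[set p : 'I_m * 'I_m | (p.1 \in A) && (p.2 \in B) && (p.2 < p.1)%N]|
          + #|A :&: B|).

Definition clmul {m} (u v : Cl m) : Cl m := fun C =>
  \big[Rplus/0]_(A : {set 'I_m})
    \big[Rplus/0]_(B : {set 'I_m} | (A :\: B) :|: (B :\: A) == C)
      (blade_sign A B * u A * v B).

Definition gen {m} (i : 'I_m) : Cl m := fun A => if A == [set i] then 1 else 0.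
Definition vec {m} (x : 'I_m -> R) : Cl m :=
  \big[cladd/cl0]_(i : 'I_m) clscal (x i) (gen i).

Definition inner {m} (x y : 'I_m -> R) : R := \big[Rplus/0]_(i : 'I_m) (x i * y i).
Definition norm2 {m} (x : 'I_m -> R) : R := inner x x.

Definition shift {m} (y : 'I_m -> R) (k : 'I_m) (t : R) : 'I_m -> R :=
  fun i => if i == k then y i + t else y i.

Definition pderiv {m} (k : 'I_m) (F : ('I_m -> R) -> Cl m) : ('I_m -> R) -> Cl m :=
  fun y A => Derive (fun t => F (shift y k t) A) 0.

Definition Gamma {m} (F : ('I_m -> R) -> Cl m) : ('I_m -> R) -> Cl m :=
  fun y => clopp (\big[cladd/cl0]_(j : 'I_m) \big[cladd/cl0]_(k : 'I_m | (j < k)%N)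
     clmul (clmul (gen j) (gen k))
           (cladd (clscal (y j) (pderiv k F y)) (clscal (- y k) (pderiv j F y)))).

(** * The fractional Clifford-Fourier kernel K_m^p(x,y) = e^{i p Gamma_y} e^{-i(x,y)}.
    e^{-i(x,y)} = sum_k (-i)^k/k! (x,y)^k, and e^{i p Gamma_y} acts on each
    homogeneous polynomial y |-> (x,y)^k by its exponential series
    sum_n (i p)^n/n! Gamma_y^n.  Values lie in the complexified algebra
    (coordinates in C). *)
Definition kernel_term {m} (p : R) (x y : 'I_m -> R) (k n : nat) (A : {set 'I_m}) : C :=
  Cmult (Cmult (Cdiv (pow_n (Cmult Ci (RtoC p)) n) (RtoC (INR (Factorial.fact n))))
               (Cdiv (pow_n (Copp Ci) k) (RtoC (INR (Factorial.fact k)))))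
        (RtoC (Nat.iter n (@Gamma m) (fun z => clscal (inner x z ^ k) cl1) y A)).

Definition CF_kernel_is (m : nat) (p : R) (x y : 'I_m -> R) (K : {set 'I_m} -> C) : Prop :=
  forall A, exists inn : nat -> C,
    (forall k, is_series (fun n => kernel_term p x y k n A) (inn k)) /\
    is_series inn (K A).

(** * Right-hand side.  cos(sqrt t) and sin(sqrt t)/sqrt t, read as the entire
    functions of t (for t < 0, sqrt t = i sqrt(-t); for t = 0, sin s/s = 1). *)
Definition cos_sqrt (t : R) : R :=
  if Rle_dec 0 t then cos (sqrt t) else cosh (sqrt (- t)).
Definition sinc_sqrt (t : R) : R :=
  if Rlt_dec 0 t then sin (sqrt t) / sqrt t
  else if Rlt_dec t 0 then sinh (sqrt (- t)) / sqrt (- t) else 1.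

Definition G_rhs {m} (x y : 'I_m -> R) (a : R) : Cl m :=
  let t := norm2 x * norm2 y - (inner x y - a) ^ 2 in
  cladd (clscal (cos_sqrt t) cl1)
        (clscal (sinc_sqrt t)
           (cladd (clopp (clmul (vec y) (vec x))) (clscal (a - inner x y) cl1))).

(** * 2x2 matrices over Cl_{0,m}; index false = 1, true = 2 *)
Definition M2 (m : nat) := bool -> bool -> Cl m.
Definition m2mul {m} (P Q : M2 m) : M2 m :=
  fun i j => cladd (clmul (P i false) (Q false j)) (clmul (P i true) (Q true j)).
Definition m2id {m} : M2 m := fun i j => if i == j then cl1 else cl0.
Fixpoint m2pow {m} (P : M2 m) (n : nat) : M2 m :=
  match n with O => m2id | S n' => m2mul P (m2pow P n') end.
Definition m2opp {m} (P : M2 m) : M2 m := fun i j => clopp (P i j).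

Definition Amat {m} (x y : 'I_m -> R) (a : R) : M2 m := fun i j =>
  match i, j with
  | false, false => clscal (a - inner x y) cl1
  | true, true => clscal (- (a - inner x y)) cl1
  | false, true => clopp (clmul (vec x) (vec y))
  | true, false => clmul (vec y) (vec x)
  end.

(** n-th term of (0 1) e^{-A} (1 1)^T = sum_n (0 1) (-A)^n (1 1)^T / n! *)
Definition expA_term {m} (x y : 'I_m -> R) (a : R) (n : nat) : Cl m :=
  let P := m2pow (m2opp (Amat x y a)) n in
  clscal (/ INR (Factorial.fact n)) (cladd (P true false) (P true true)).

(* Main.v *)
Require Import Defs.
From HB Require Import structures.
From Stdlib Require Import Reals Lra FunctionalExtensionality.
From Coquelicot Require Import Coquelicot.
From mathcomp Require Import ssreflect ssrfun ssrbool eqtype ssrnat seq choice fintype finset bigop.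

Local Open Scope R_scope.

(** Write [s = (x,y)], [rho = |x|^2 |y|^2] and [w = x /\ y], so that
    [w^2 = s^2 - rho] in the Clifford algebra.

    Matrix part: [A^2 = -(rho - (s - a)^2)] is scalar, so the exponential series
    splits into its even and odd halves.

    Kernel part: on the functions [P(s, rho) + Q(s, rho) w], [Gamma_y] acts in
    dimension [m = 2n+2] as a differential operator [D_m] in [s].  For [m = 2]
    it is the derivation with [s |-> w], [w |-> s], so [(s+w)^i (s-w)^j] is an
    eigenvector with eigenvalue [i - j], and [exp (i pi/2 D_2)] sends [s] to
    [i w].  Let [T (P + Q w)] be the [n]-th [a]-derivative at [a = 0] of
    [P(s-a) + Q(s-a) (w+a)].  Then [D_m T = T (D_2 + n)].  Up to a
    constant [s^k] is [T (s^(k+n))], so the [k]-th inner sum of the kernel is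
    [T (w^N) / N!] with [N = k+n].  These terms vanish for [N < n], hence
    the kernel is [T (exp w)].  As [exp w = cos sqrt(-w^2) + w sinc sqrt(-w^2)],
    this is the [n]-th derivative at [a = 0] of the generating function. *)

(** * The Clifford algebra *)

Fact Rplus_associative : associative Rplus.
Proof. by move=> a b c; ring. Qed.

Fact Rmult_associative : associative Rmult.
Proof. by move=> a b c; ring. Qed.

HB.instance Definition _ := Monoid.isComLaw.Build R 0 Rplus Rplus_associative Rplus_comm Rplus_0_l.
HB.instance Definition _ := Monoid.isComLaw.Build R 1 Rmult Rmult_associative Rmult_comm Rmult_1_l.
HB.instance Definition _ := Monoid.isMulLaw.Build R 0 Rmult Rmult_0_l Rmult_0_r.
HB.instance Definition _ :=
  Monoid.isAddLaw.Build R Rmult Rplus Rmult_plus_distr_r Rmult_plus_distr_l.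

Section Blades.
Context {m : nat}.
Implicit Types (A B C : {set 'I_m}) (u v w : Cl m).

Definition symdiff A B := (A :\: B) :|: (B :\: A).

Lemma in_symdiff A B i : (i \in symdiff A B) = (i \in A) (+) (i \in B).
Proof. by rewrite !inE; case: (i \in A); case: (i \in B). Qed.

Lemma symdiffA A B C : symdiff A (symdiff B C) = symdiff (symdiff A B) C.
Proof. by apply/setP => i; rewrite !in_symdiff addbA. Qed.

Lemma symdiffC A B : symdiff A B = symdiff B A.
Proof. by apply/setP => i; rewrite !in_symdiff addbC. Qed.

Lemma symdiffK A B : symdiff A (symdiff A B) = B.
Proof. by apply/setP => i; rewrite !in_symdiff addKb. Qed.

Lemma symdiff0 A : symdiff A set0 = A.
Proof. by apply/setP => i; rewrite in_symdiff inE addbF. Qed.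

Lemma symdiffv A : symdiff A A = set0.
Proof. by rewrite -{2}(symdiff0 A) symdiffK. Qed.

Lemma pow_card (I : finType) (S : {set I}) :
  (-1) ^ #|S| = \big[Rmult/1]_(i : I) (if i \in S then -1 else 1).
Proof.
rewrite -big_mkcond /= -sum1_card (big_morph (pow (-1)) (id1 := 1) (op1 := Rmult)) //.
- by apply: eq_bigr => i _; ring.
- by move=> a b; rewrite pow_add.
Qed.

(* The diagonal pairs [j = i] account for the summand [#|A :&: B|] of the exponent. *)
Lemma blade_signE A B :
  blade_sign A B = \big[Rmult/1]_(i : 'I_m) \big[Rmult/1]_(j : 'I_m)
    (if [&& i \in A, j \in B & (j <= i)%N] then -1 else 1).
Proof.
rewrite /blade_sign pow_add !pow_card.
set S := finset _.
have -> : \big[Rmult/1]_(p : 'I_m * 'I_m) (if p \in S then -1 else 1)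
  = \big[Rmult/1]_(i : 'I_m) \big[Rmult/1]_(j : 'I_m) (if (i, j) \in S then -1 else 1).
  by rewrite pair_bigA; apply: eq_bigr => -[].
rewrite -big_split /=.
apply: eq_bigr => i _.
have -> : (if i \in A :&: B then -1 else 1)
  = \big[Rmult/1]_(j : 'I_m) (if (j == i) && (i \in A :&: B) then -1 else 1).
  rewrite (bigD1 i) //= eqxx big1 /=; first by rewrite Rmult_1_r.
  by move=> j /negbTE ->.
rewrite -big_split /=; apply: eq_bigr => j _.
rewrite !inE /= [(j <= i)%N]leq_eqVlt.
have [->|ji] := eqVneq j i.
  by rewrite ltnn eqxx andbF andbT /= ; ring.
have -> : (nat_of_ord j == i) = false by apply/negbTE.
by rewrite /= Rmult_1_r andbA.
Qed.

(** Each factor in [blade_signE] depends on [A] only through membership, and membership in a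
    symmetric difference is additive mod 2. With [blade_signDr] this makes the sign
    bimultiplicative. *)
Lemma blade_signDl A B C :
  blade_sign (symdiff A B) C = blade_sign A C * blade_sign B C.
Proof.
rewrite !blade_signE -big_split; apply: eq_bigr => i _.
rewrite -big_split; apply: eq_bigr => j _; rewrite in_symdiff /=.
by case: (i \in A); case: (i \in B); case: (j \in C); case: (j <= i)%N => /=; ring.
Qed.

Lemma blade_signDr A B C :
  blade_sign A (symdiff B C) = blade_sign A B * blade_sign A C.
Proof.
rewrite !blade_signE -big_split; apply: eq_bigr => i _.
rewrite -big_split; apply: eq_bigr => j _; rewrite in_symdiff /=.
by case: (i \in A); case: (j \in B); case: (j \in C); case: (j <= i)%N => /=; ring.
Qed.

Lemma blade_sign_sqr A B : blade_sign A B * blade_sign A B = 1.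
Proof.
by rewrite /blade_sign -Rpow_mult_distr (_ : -1 * -1 = 1) ?pow1 //; ring.
Qed.

Lemma blade_sign0l A : blade_sign set0 A = 1.
Proof.
by rewrite blade_signE big1 // => i _; rewrite big1 // => j _; rewrite inE.
Qed.

Lemma blade_sign0r A : blade_sign A set0 = 1.
Proof.
by rewrite blade_signE big1 // => i _; rewrite big1 // => j _; rewrite inE andbF.
Qed.

Lemma clmulE u v C :
  clmul u v C = \big[Rplus/0]_(A : {set 'I_m})
                   (blade_sign A (symdiff A C) * u A * v (symdiff A C)).
Proof.
apply: eq_bigr => A _; rewrite (big_pred1 (symdiff A C)) // => B /=.
rewrite -/(symdiff A B); apply/eqP/eqP => [<-|->]; by rewrite symdiffK.
Qed.

Lemma clmulA u v w : clmul (clmul u v) w = clmul u (clmul v w).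
Proof.
apply: functional_extensionality => C; rewrite !clmulE.
under eq_bigr => A _.
  rewrite clmulE big_distrr big_distrl /=.
  over.
rewrite exchange_big /=; apply: eq_bigr => B _.
rewrite clmulE big_distrr /= (reindex_inj (h := symdiff B)) /=; last first.
  by move=> A1 A2 E; rewrite -(symdiffK B A1) E symdiffK.
apply: eq_bigr => A _; rewrite symdiffK symdiffA (symdiffC A B) !blade_signDr !blade_signDl.
(* Expanded by bimultiplicativity, the left sign is the right one times the square of
   [blade_sign B A]. *)
rewrite -[RHS]Rmult_1_l -(blade_sign_sqr B A); ring.
Qed.

Lemma clmul1l u : clmul cl1 u = u.
Proof.
apply: functional_extensionality => C; rewrite clmulE (bigD1 set0) //= big1.
  by rewrite /cl1 eqxx blade_sign0l symdiffC symdiff0; ring.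
by move=> A /negbTE HA; rewrite /cl1 HA; ring.
Qed.

Lemma clmul1r u : clmul u cl1 = u.
Proof.
apply: functional_extensionality => C; rewrite clmulE (bigD1 C) //= big1.
  by rewrite symdiffv /cl1 eqxx blade_sign0r; ring.
move=> A AC; rewrite /cl1 ifF; first by ring.
by apply/negbTE; apply: contra AC => /eqP E; rewrite -(symdiffK A C) E symdiff0.
Qed.

Lemma clmulDl u v w : clmul (cladd u v) w = cladd (clmul u w) (clmul v w).
Proof.
apply: functional_extensionality => C; rewrite /cladd !clmulE -big_split.
by apply: eq_bigr => A _ /=; ring.
Qed.

Lemma clmulDr u v w : clmul w (cladd u v) = cladd (clmul w u) (clmul w v).
Proof.
apply: functional_extensionality => C; rewrite /cladd !clmulE -big_split.
by apply: eq_bigr => A _ /=; ring.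
Qed.

Lemma clmulZl r u v : clmul (clscal r u) v = clscal r (clmul u v).
Proof.
apply: functional_extensionality => C; rewrite /clscal !clmulE big_distrr.
by apply: eq_bigr => A _ /=; ring.
Qed.

Lemma clmulZr r u v : clmul u (clscal r v) = clscal r (clmul u v).
Proof.
apply: functional_extensionality => C; rewrite /clscal !clmulE big_distrr.
by apply: eq_bigr => A _ /=; ring.
Qed.

Lemma cloppE u : clopp u = clscal (-1) u.
Proof. by apply: functional_extensionality => C; rewrite /clopp /clscal; ring. Qed.

Lemma clmulNl u v : clmul (clopp u) v = clopp (clmul u v).
Proof. by rewrite !cloppE clmulZl. Qed.

Lemma clmulNr u v : clmul u (clopp v) = clopp (clmul u v).
Proof. by rewrite !cloppE clmulZr. Qed.

Lemma clmul0l u : clmul cl0 u = cl0.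
Proof.
by apply: functional_extensionality => C; rewrite clmulE big1 // => A _; rewrite /cl0; ring.
Qed.

Lemma clmul0r u : clmul u cl0 = cl0.
Proof.
by apply: functional_extensionality => C; rewrite clmulE big1 // => A _; rewrite /cl0; ring.
Qed.

Lemma clsumE I (r : seq I) (P : pred I) (F : I -> Cl m) A :
  (\big[cladd/cl0]_(i <- r | P i) F i) A = \big[Rplus/0]_(i <- r | P i) F i A.
Proof. exact: (big_morph (fun u : Cl m => u A)). Qed.

Lemma clmul_suml I (r : seq I) (P : pred I) (F : I -> Cl m) v :
  clmul (\big[cladd/cl0]_(i <- r | P i) F i) v
  = \big[cladd/cl0]_(i <- r | P i) clmul (F i) v.
Proof. exact: (big_morph (clmul^~ v) (fun a b => clmulDl a b v) (clmul0l v)). Qed.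

Lemma clmul_sumr I (r : seq I) (P : pred I) (F : I -> Cl m) v :
  clmul v (\big[cladd/cl0]_(i <- r | P i) F i)
  = \big[cladd/cl0]_(i <- r | P i) clmul v (F i).
Proof. exact: (big_morph (clmul v) (fun a b => clmulDr a b v) (clmul0r v)). Qed.

End Blades.

Ltac clring := apply: functional_extensionality => ?;
  rewrite /cladd /clscal /clopp /cl0; ring.

(** * Products of vectors, and sums over pairs of generators *)

Section Vectors.
Context {m : nat}.
Implicit Types (i j k : 'I_m) (x y z : 'I_m -> R) (A : {set 'I_m}).

Lemma clmul_gen i j A :
  clmul (gen i) (gen j) A
  = if A == symdiff [set i] [set j] then blade_sign [set i] [set j] else 0.
Proof.
rewrite clmulE (bigD1 [set i]) //= big1; last by move=> B /negbTE iB; rewrite /gen iB; ring.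
rewrite /gen eqxx (_ : (symdiff [set i] A == [set j]) = (A == symdiff [set i] [set j])).
  by case: eqP => [->|_]; rewrite ?symdiffK; ring.
by apply/eqP/eqP => [<-|->]; rewrite symdiffK.
Qed.

Lemma blade_sign_gen i j : blade_sign [set i] [set j] = if (j <= i)%N then -1 else 1.
Proof.
rewrite blade_signE (bigD1 i) //= [X in _ * X]big1; last first.
  by move=> k /negbTE ki; rewrite big1 // => l _; rewrite !inE ki.
rewrite Rmult_1_r (bigD1 j) //= big1 ?inE ?eqxx /= ?Rmult_1_r ?inE ?eqxx //.
by move=> k /negbTE kj; rewrite !inE kj.
Qed.

Lemma gen_sqr i : clmul (gen i) (gen i) = clopp cl1.
Proof.
apply: functional_extensionality => A; rewrite clmul_gen blade_sign_gen leqnn /clopp /cl1.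
by rewrite symdiffv; case: ifP => _; ring.
Qed.

Lemma genC i j : i != j -> clmul (gen i) (gen j) = clopp (clmul (gen j) (gen i)).
Proof.
move=> ij; apply: functional_extensionality => A.
rewrite /clopp !clmul_gen !blade_sign_gen (symdiffC [set j]).
have : nat_of_ord i != j by [].
by case: (ltngtP i j) => // _ _; case: ifP => _; ring.
Qed.

(** Folding the lower triangle onto the upper one relates products of whole vectors to the sums over
    [j < k] in [Gamma]. *)
Lemma sum_pairs (M : 'I_m -> 'I_m -> R) :
  \big[Rplus/0]_(j : 'I_m) \big[Rplus/0]_(k : 'I_m) M j k
  = \big[Rplus/0]_(j : 'I_m) \big[Rplus/0]_(k : 'I_m | (j < k)%N) (M j k + M k j)
    + \big[Rplus/0]_(j : 'I_m) M j j.
Proof.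
under [X in _ = X + _]eq_bigr => j _ do rewrite big_split /=.
rewrite big_split /= [X in _ = _ + X + _](exchange_big_dep xpredT) //= -!big_split /=.
apply: eq_bigr => j _; rewrite (bigD1 j) //= Rplus_comm; congr (_ + _).
rewrite (bigID (fun k : 'I_m => (j < k)%N)) /=; congr (_ + _).
  apply: eq_bigl => k; rewrite andbC; case: (ltngtP j k) => //= jk.
  by apply/eqP => E; rewrite E ltnn in jk.
apply: eq_bigl => k; case: (ltngtP j k) => //= jk; rewrite ?andbF ?andbT //.
  by apply/eqP => E; rewrite E ltnn in jk.
by apply/negbTE; rewrite negbK; apply/eqP/val_inj.
Qed.

Lemma vec_mul z x : clmul (vec z) (vec x) = \big[cladd/cl0]_(j : 'I_m)
   \big[cladd/cl0]_(k : 'I_m) clscal (z j * x k) (clmul (gen j) (gen k)).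
Proof.
rewrite clmul_suml; apply: eq_bigr => j _; rewrite clmul_sumr; apply: eq_bigr => k _.
by rewrite clmulZl clmulZr; clring.
Qed.

Lemma inner_sym x y : inner x y = inner y x.
Proof. by apply: eq_bigr => i _; ring. Qed.

(** This is [x /\ z], because [xz + zx = -2 (x,z)]; the form [-zx - (x,z)] is the one that occurs in
    [G_rhs]. *)
Definition bivec x z : Cl m :=
  cladd (clopp (clmul (vec z) (vec x))) (clscal (- inner x z) cl1).

Lemma bivec_pairs x z :
  \big[cladd/cl0]_(j : 'I_m) \big[cladd/cl0]_(k : 'I_m | (j < k)%N)
    clscal (z j * x k - z k * x j) (clmul (gen j) (gen k)) = clopp (bivec x z).
Proof.
apply: functional_extensionality => A.
have -> : clopp (bivec x z) A = clmul (vec z) (vec x) A + inner x z * cl1 A.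
  by rewrite /bivec /clopp /cladd /clscal; ring.
rewrite vec_mul !clsumE.
under [X in _ = X + _]eq_bigr => j _ do rewrite clsumE.
rewrite sum_pairs.
have -> : \big[Rplus/0]_(j : 'I_m) clscal (z j * x j) (clmul (gen j) (gen j)) A
    = - (inner x z * cl1 A).
  rewrite /inner big_distrl (big_morph Ropp Ropp_plus_distr Ropp_0) /=.
  by apply: eq_bigr => j _; rewrite gen_sqr /clscal /clopp /=; ring.
rewrite Rplus_assoc Rplus_opp_l Rplus_0_r.
apply: eq_bigr => j _; rewrite clsumE; apply: eq_bigr => k jk.
rewrite (@genC k j) /clscal /clopp; first by ring.
by apply: contraTneq jk => ->; rewrite ltnn.
Qed.

(** The left side of [bivec_pairs] changes sign when [x] and [z] are exchanged, so [bivec] is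
    antisymmetric, which is this relation. *)
Lemma vecC x z :
  clmul (vec x) (vec z) = cladd (clopp (clmul (vec z) (vec x))) (clscal (- 2 * inner x z) cl1).
Proof.
have E1 := bivec_pairs x z; have E2 := bivec_pairs z x.
have E : cladd (bivec x z) (bivec z x) = cl0.
  apply: functional_extensionality => A.
  have := f_equal (fun u : Cl m => u A) E1; have := f_equal (fun u : Cl m => u A) E2.
  rewrite /cladd /clopp /cl0 !clsumE => H2 H1.
  suff : - bivec x z A + - bivec z x A = 0 by lra.
  rewrite -H1 -H2 -big_split big1 // => j _; rewrite !clsumE -big_split big1 // => k _.
  by rewrite /clscal /=; ring.
apply: functional_extensionality => A; have := f_equal (fun u : Cl m => u A) E.
by rewrite /bivec /cladd /clopp /clscal /cl0 (inner_sym z x); lra.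
Qed.

Lemma vec_sqr x : clmul (vec x) (vec x) = clscal (- norm2 x) cl1.
Proof.
apply: functional_extensionality => A; have := f_equal (fun u : Cl m => u A) (vecC x x).
by rewrite /cladd /clopp /clscal /norm2; lra.
Qed.

Lemma clmul_yxxy x y :
  clmul (clmul (vec y) (vec x)) (clmul (vec x) (vec y)) = clscal (norm2 x * norm2 y) cl1.
Proof.
by rewrite clmulA -(clmulA (vec x) (vec x)) vec_sqr clmulZl clmul1l clmulZr vec_sqr; clring.
Qed.

Lemma bivec_sqr x z :
  clmul (bivec x z) (bivec x z)
  = clscal (inner x z ^ 2 - norm2 x * norm2 z) cl1.
Proof.
have E : clmul (clmul (vec z) (vec x)) (clmul (vec z) (vec x))
   = cladd (clscal (- (norm2 x * norm2 z)) cl1)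
           (clscal (- 2 * inner x z) (clmul (vec z) (vec x))).
  (* Writing the second factor [zx] as [-xz - 2 (x,z)] lets [(zx)(xz)] collapse to a scalar. *)
  rewrite {2}(vecC z x) clmulDr clmulNr clmul_yxxy clmulZr clmul1r (inner_sym z x).
  by clring.
rewrite /bivec !clmulDl !clmulDr !clmulNl !clmulNr !clmulZl !clmulZr clmul1l !clmul1r E.
by clring.
Qed.

Lemma gen_triple z j k : j != k ->
  clmul (clmul (gen j) (gen k)) (cladd (clscal (z j) (gen k)) (clscal (- z k) (gen j)))
  = clopp (cladd (clscal (z j) (gen j)) (clscal (z k) (gen k))).
Proof.
move=> jk; rewrite clmulDr !clmulZr clmulA gen_sqr clmulNr clmul1r.
rewrite (genC _ _ jk) clmulNl clmulA gen_sqr clmulNr clmul1r; clring.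
Qed.

(** By [gen_triple] a pair contributes [-(z_j e_j + z_k e_k)], and each index lies in [m - 1]
    pairs. *)
Lemma vec_pairs z :
  \big[cladd/cl0]_(j : 'I_m) \big[cladd/cl0]_(k : 'I_m | (j < k)%N)
    clmul (clmul (gen j) (gen k)) (cladd (clscal (z j) (gen k)) (clscal (- z k) (gen j)))
  = clscal (- (INR m - 1)) (vec z).
Proof.
apply: functional_extensionality => A; rewrite /clscal clsumE.
have := sum_pairs (fun j k => z j * gen j A).
have C c : \big[Rplus/0]_(k : 'I_m) c = INR m * c.
  rewrite big_const card_ord; elim: m => [|n IH]; first by rewrite /=; ring.
  by rewrite iterS IH S_INR; ring.
under [X in X = _ -> _]eq_bigr => j _ do rewrite C.
rewrite -big_distrr /vec clsumE /clscal /= => E.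
have -> : - (INR m - 1) * (\big[Rplus/0]_(j < m) (z j * gen j A))
   = - (INR m * (\big[Rplus/0]_(j < m) (z j * gen j A))
       - \big[Rplus/0]_(j < m) (z j * gen j A)) by ring.
rewrite E /Rminus Rplus_assoc Rplus_opp_r Rplus_0_r.
rewrite (big_morph Ropp Ropp_plus_distr Ropp_0); apply: eq_bigr => j _.
rewrite clsumE (big_morph Ropp Ropp_plus_distr Ropp_0); apply: eq_bigr => k jk.
rewrite gen_triple //; by apply: contraTneq jk => ->; rewrite ltnn.
Qed.

(** Up to sign this is [Gamma] applied to [bivec x], whose partial derivatives are the inner
    brackets. [vec_pairs] times [x] gives [(m - 1) zx], and [bivec_pairs] gives one further
    bivector, which turns [m - 1] into [m - 2]. *)
Lemma bivec_gen_pairs x z :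
  \big[cladd/cl0]_(j : 'I_m) \big[cladd/cl0]_(k : 'I_m | (j < k)%N)
    clmul (clmul (gen j) (gen k))
      (cladd (clscal (z j) (cladd (clopp (clmul (gen k) (vec x))) (clscal (- x k) cl1)))
             (clscal (- z k) (cladd (clopp (clmul (gen j) (vec x))) (clscal (- x j) cl1))))
  = cladd (clscal (- (INR m - 2)) (bivec x z)) (clscal (- (INR m - 1) * inner x z) cl1).
Proof.
have E : forall j k, 
    clmul (clmul (gen j) (gen k))
      (cladd (clscal (z j) (cladd (clopp (clmul (gen k) (vec x))) (clscal (- x k) cl1)))
             (clscal (- z k) (cladd (clopp (clmul (gen j) (vec x))) (clscal (- x j) cl1))))
  = cladd (clmul (clopp (clmul (clmul (gen j) (gen k))
              (cladd (clscal (z j) (gen k)) (clscal (- z k) (gen j))))) (vec x))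
     (clopp (clscal (z j * x k - z k * x j) (clmul (gen j) (gen k)))).
  move=> j k; rewrite !(clmulDr, clmulZr, clmulNr, clmul1r, clmulNl, clmulDl, clmulZl, clmulA).
  by clring.
apply: functional_extensionality => A.
have /(f_equal (fun u : Cl m => clmul u (vec x) A)) := vec_pairs z.
have /(f_equal (fun u : Cl m => u A)) := bivec_pairs x z.
rewrite clmul_suml !clsumE clmulZl.
under [X in _ -> X = _ -> _]eq_bigr => j _ do rewrite clmul_suml clsumE.
under [X in X = _ -> _]eq_bigr => j _ do rewrite clsumE.
move=> H1 H2.
under eq_bigr => j _.
  rewrite clsumE; under eq_bigr => k _ do rewrite E /cladd clmulNl {1 2}/clopp.
  rewrite big_split -!(big_morph Ropp Ropp_plus_distr Ropp_0) /=; over.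
rewrite big_split -!(big_morph Ropp Ropp_plus_distr Ropp_0) /= H1 H2.
by rewrite /bivec /cladd /clopp /clscal; ring.
Qed.
End Vectors.

Lemma is_derive_idR (t : R) : is_derive (fun u => u) t 1.
Proof. exact: is_derive_id. Qed.

Lemma is_derive_mulR (f g : R -> R) (t df dg : R) :
  is_derive f t df -> is_derive g t dg ->
  is_derive (fun u => f u * g u) t (df * g t + f t * dg).
Proof. by move=> Hf Hg; apply: is_derive_mult => //; exact: Rmult_comm. Qed.

Lemma is_derive_eq (f g : R -> R) (t df dg : R) :
  is_derive f t df -> (forall u, f u = g u) -> df = dg -> is_derive g t dg.
Proof. by move=> Hf fg <-; apply: is_derive_ext Hf. Qed.

(** * Towers of derivatives *)

(** Carrying all derivatives along reduces an identity between [n]-th derivatives to an identity of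
    functions, by [jet_uniq]. *)
Definition jet (d : nat -> R -> R) := forall n (b : R), is_derive (d n) b (d (S n) b).

Lemma jet_Derive_n d n b : jet d -> Derive_n (d 0%N) n b = d n b.
Proof.
move=> dP; elim: n b => [//|n IH] b /=.
by rewrite (Derive_ext _ _ b IH); apply: is_derive_unique.
Qed.

(* Leibniz rule for [b |-> b * f b]; at [n = 0] the junk value [d (pred 0)] is multiplied by 0. *)
Definition mulb_jet (d : nat -> R -> R) n b := b * d n b + INR n * d (Nat.pred n) b.

Lemma jet_mulb d : jet d -> jet (mulb_jet d).
Proof.
move=> dP n b; have H1 := is_derive_mulR _ _ _ _ _ (is_derive_idR b) (dP n b).
case: n H1 => [|n] H1.
  by apply: (is_derive_eq _ _ _ _ _ H1) => [t|]; rewrite /mulb_jet /=; ring.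
have H2 := is_derive_scal (d n) b (INR n.+1) _ (dP n b).
apply: (is_derive_eq _ _ _ _ _ (is_derive_plus _ _ _ _ _ H1 H2)).
  by [].
by rewrite /mulb_jet (S_INR n.+1) /plus /=; ring.
Qed.

Section Tau.
Variable rho : R.

(* [dtau F n] is the [n]-th derivative of [b |-> F 0 (rho - b^2)] when [F] is a
   jet.  It involves [F] only through its values at [rho - b^2], linearly, which
   reduces termwise differentiation of the composite to that of a power series. *)
Fixpoint dtau (F : nat -> R -> R) (n : nat) (b : R) : R :=
  match n with
  | O => F 0%N (rho - b ^ 2)
  | S n' => -2 * (b * dtau (fun l => F (S l)) n' b +
      match n' with O => 0 | S n'' => INR n' * dtau (fun l => F (S l)) n'' b end)
  end.

(** One derivative of [F 0 (rho - b^2)] is [-2 b] times [F 1 (rho - b^2)]; the remaining [n] follow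
    the Leibniz rule. *)
Lemma dtauS F n b :
  dtau F n.+1 b = -2 * mulb_jet (dtau (fun l => F (S l))) n b.
Proof. by rewrite /mulb_jet; case: n => [|n] //=; ring. Qed.

(** This induction follows the recursion of [dtau], where [mulb_jet] refers to both [n] and its
    predecessor. *)
Lemma nat_ind_pred (P : nat -> Prop) :
  P 0%N -> (forall n, P (Nat.pred n) -> P n -> P n.+1) -> forall n, P n.
Proof.
move=> P0 PS n; suff [] : P (Nat.pred n) /\ P n by [].
by elim: n => [|n [Hp Hn]] //; split=> //; apply: PS.
Qed.

Lemma jet_dtau F : jet F -> jet (dtau F).
Proof.
move=> FP n; elim/nat_ind_pred: n F FP => [|n IHp IH] F FP b.
  have Hd : is_derive (fun b => rho - b ^ 2) b (-2 * b) by auto_derive => //; ring.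
  apply: (is_derive_eq _ _ _ _ _
    (is_derive_comp (F 0%N) (fun b => rho - b ^ 2) b _ _ (FP 0%N _) Hd)) => //.
  by rewrite /scal /=; rewrite /mult /= /mult /=; ring.
have SP : jet (fun l => F (S l)) by move=> l t; exact: FP.
have H1 := is_derive_mulR _ _ _ _ _ (is_derive_idR b) (IH _ SP b).
rewrite dtauS; case: n IHp IH H1 => [|n] IHp IH H1.
  apply: (is_derive_eq _ _ _ _ _ (is_derive_scal _ b (-2) _ H1)) => [t|].
    by rewrite dtauS /mulb_jet /=; ring.
  by rewrite /mulb_jet /=; ring.
apply: (is_derive_eq _ _ _ _ _ (is_derive_scal _ b (-2) _
  (is_derive_plus _ _ _ _ _ H1 (is_derive_scal _ b (INR n.+1) _ (IHp _ SP b))))).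
  by move=> t; rewrite [RHS]dtauS.
by rewrite /mulb_jet [Nat.pred _]/= (S_INR n.+1) /plus; cbn -[INR dtau]; ring.
Qed.

Lemma is_series_dtau (F : nat -> nat -> R -> R) (G : nat -> R -> R) n b :
  (forall l, is_series (fun j => F j l (rho - b ^ 2)) (G l (rho - b ^ 2))) ->
  is_series (fun j => dtau (F j) n b) (dtau G n b).
Proof.
elim/nat_ind_pred: n F G => [|n IHp IH] F G FG; first exact: FG.
apply: (is_series_ext (fun j => -2 * mulb_jet (dtau (fun l => F j (S l))) n b)).
  by move=> j; rewrite dtauS.
rewrite dtauS; apply: is_series_scal; apply: is_series_plus; apply: is_series_scal.
  by apply: (IH (fun j l => F j (S l))) => l.
by apply: (IHp (fun j l => F j (S l))) => l.
Qed.

(** [F 0] plays the part of a polynomial of degree below [d]; composed with [rho - b^2] it has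
    degree at most [2d - 2] in [b], so it dies from order [2d - 1] on. *)
Lemma dtau_vanish F d n b :
  (forall l t, (d <= l)%N -> F l t = 0) -> (d.*2 <= n.+1)%N -> dtau F n b = 0.
Proof.
elim/nat_ind_pred: n F d => [|n IHp IH] F d F0.
  by case: d F0 => // F0 _; apply: F0.
rewrite dtauS /mulb_jet => dn.
have SF0 : forall l t, (d.-1 <= l)%N -> F l.+1 t = 0.
  by move=> l t dl; apply: F0; move: dl; case: (d).
have dn' : (d.-1.*2 <= n)%N by move: dn; case: (d) => //= d'; rewrite doubleS !ltnS.
rewrite (IH _ _ SF0) ?(leqW dn') //; case: n {IH dn} IHp dn' => [|n] IHp dn'.
  by rewrite /=; ring.
by rewrite (IHp _ _ SF0) //; ring.
Qed.

End Tau.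

(** * Derivatives of monomials and of entire power series *)

Fixpoint pow_jet (j l : nat) (t : R) {struct l} : R :=
  match l, j with
  | O, _ => t ^ j
  | S l', O => 0
  | S l', S j' => INR j * pow_jet j' l' t
  end.

Lemma jet_pow j : jet (pow_jet j).
Proof.
move=> l; elim: l j => [|l IH] [|j] b /=.
- by apply: is_derive_ext (is_derive_const 1 b).
- change (is_derive (fun t => t ^ j.+1) b (INR j.+1 * b ^ j)).
  by auto_derive => //; rewrite -/(INR j.+1); ring.
- exact: is_derive_const.
- by apply: is_derive_scal; apply: IH.
Qed.

Lemma pow_jet_vanish j l t : (j < l)%N -> pow_jet j l t = 0.
Proof. by elim: l j => [|l IH] [|j] //= jl; rewrite IH //; ring. Qed.

Section EntireSeries.
Variable (a : nat -> R).

Definition entire_jet l := PSeries (iter l PS_derive a).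

Hypothesis a_entire : CV_radius a = p_infty.

Lemma CV_radius_iter_derive l : CV_radius (iter l PS_derive a) = p_infty.
Proof. by elim: l => //= l IH; rewrite CV_radius_derive. Qed.

Lemma jet_entire : jet entire_jet.
Proof.
move=> l t; rewrite /entire_jet iterS.
by apply: is_derive_PSeries; rewrite CV_radius_iter_derive.
Qed.
End EntireSeries.

Lemma is_series_entire a l t : CV_radius a = p_infty ->
  is_series (fun j => a j * pow_jet j l t) (entire_jet a l t).
Proof.
elim: l a => [|l IH] a aE.
  have : ex_pseries a t by apply: CV_radius_inside; rewrite aE.
  move=> /PSeries_correct /is_pseries_R H.
  by apply: is_series_ext H => j /=.
(* A derivative of positive order kills the term of index 0, and the shifted series is that of
   [PS_derive a]. *)
apply: is_series_decr_1; rewrite /= Rmult_0_r.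
have := IH (PS_derive a); rewrite CV_radius_derive => /(_ aE).
rewrite /entire_jet -iterSr /plus /opp /= Ropp_0 Rplus_0_r.
by apply: is_series_ext => j; rewrite /PS_derive /=; ring.
Qed.

(** * The series of cos_sqrt, sinc_sqrt and exp (i t) *)

Lemma is_series_eq (u v : nat -> R) (l : R) :
  is_series u l -> (forall n, u n = v n) -> is_series v l.
Proof. by move=> H E; apply: is_series_ext H. Qed.

Lemma CV_radius_cos_n : CV_radius cos_n = p_infty.
Proof.
by apply: CV_radius_infinite_DAlembert; [exact: cosn_no_R0|exact/is_lim_seq_Reals/Alembert_cos].
Qed.

Lemma CV_radius_sin_n : CV_radius sin_n = p_infty.
Proof.
apply: CV_radius_infinite_DAlembert; last exact/is_lim_seq_Reals/Alembert_sin.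
move=> n; apply: Rmult_integral_contrapositive_currified.
  by apply: pow_nonzero; lra.
exact/Rinv_neq_0_compat/INR_fact_neq_0.
Qed.

Lemma is_series_scalR c (u : nat -> R) (l : R) :
  is_series u l -> is_series (fun n => c * u n) (c * l).
Proof. by move=> H; apply: is_series_scal. Qed.

Lemma is_series_PSeries (a : nat -> R) t : CV_radius a = p_infty ->
  is_series (fun j => a j * t ^ j) (PSeries a t).
Proof. by move=> aE; have := is_series_entire a 0 t aE. Qed.

Lemma is_series_uniq (u : nat -> R) l l' : is_series u l -> is_series u l' -> l = l'.
Proof. by move=> /is_series_unique <- /is_series_unique. Qed.

Lemma cosE x : cos x = PSeries cos_n (x ^ 2).
Proof.
rewrite /cos; case: exist_cos => l /is_series_Reals H.
apply: is_series_uniq H _; rewrite /Rsqr (_ : x * x = x ^ 2); last by ring.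
exact/is_series_PSeries/CV_radius_cos_n.
Qed.

Lemma sinE x : sin x = x * PSeries sin_n (x ^ 2).
Proof.
rewrite /sin; case: exist_sin => l /is_series_Reals H; congr (_ * _).
apply: is_series_uniq H _; rewrite /Rsqr (_ : x * x = x ^ 2); last by ring.
exact/is_series_PSeries/CV_radius_sin_n.
Qed.

Lemma opp_pow r j : (- r) ^ j = (-1) ^ j * r ^ j.
Proof. by rewrite -Rpow_mult_distr; congr (_ ^ _); ring. Qed.

(** The even and odd parts of the exponential series are those of [cos_n] and [sin_n] at [-x^2],
    where the alternating signs cancel. This serves the hyperbolic branches of [cos_sqrt] and
    [sinc_sqrt]. *)
Lemma expE x : exp x = PSeries cos_n (- x ^ 2) + x * PSeries sin_n (- x ^ 2).
Proof.
apply: (is_series_uniq (fun n => / INR (Factorial.fact n) * x ^ n)).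
  by apply/is_pseries_R/is_exp_Reals.
apply/is_pseries_R; apply: is_pseries_odd_even; apply/is_pseries_R.
  apply: (is_series_eq _ _ _ (is_series_PSeries _ (- x ^ 2) CV_radius_cos_n)) => j.
  rewrite /cos_n -{2}(Ropp_involutive (x ^ 2)) (opp_pow (- x ^ 2)).
  by rewrite /Rdiv -/(INR (Factorial.fact (2 * j))); ring.
apply: (is_series_eq _ _ _ (is_series_PSeries _ (- x ^ 2) CV_radius_sin_n)) => j.
rewrite /sin_n -{2}(Ropp_involutive (x ^ 2)) (opp_pow (- x ^ 2)).
by rewrite /Rdiv -/(INR (Factorial.fact (2 * j + 1))); ring.
Qed.

Lemma cos_sqrtE t : cos_sqrt t = PSeries cos_n t.
Proof.
rewrite /cos_sqrt; case: Rle_dec => t0 /=; first by rewrite cosE pow2_sqrt.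
have E : - sqrt (- t) ^ 2 = t by rewrite pow2_sqrt; lra.
rewrite /cosh !expE (_ : (- sqrt (- t)) ^ 2 = sqrt (- t) ^ 2); last by ring.
by rewrite E; field.
Qed.

Lemma sinc_sqrtE t : sinc_sqrt t = PSeries sin_n t.
Proof.
rewrite /sinc_sqrt; case: Rlt_dec => t0 /=.
  have st : sqrt t <> 0 by have := sqrt_lt_R0 _ t0; lra.
  by rewrite sinE pow2_sqrt; [field|lra].
case: Rlt_dec => t1 /=.
  have E : - sqrt (- t) ^ 2 = t by rewrite pow2_sqrt; lra.
  have st : sqrt (- t) <> 0 by have := sqrt_lt_R0 (- t); lra.
  rewrite /sinh !expE (_ : (- sqrt (- t)) ^ 2 = sqrt (- t) ^ 2); last by ring.
  by rewrite E; field.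
have -> : t = 0 by lra.
by rewrite PSeries_0 /sin_n /= Rdiv_1_r.
Qed.

(** The shape of the powers of an element with scalar square; here [i t], the bivector and the
    matrix [-A]. *)
Definition alternate {V : Type} (u v : nat -> V) (n : nat) : V :=
  if odd n then v n./2 else u n./2.

Lemma is_series_alternate (u v : nat -> R) (lu lv : R) :
  is_series u lu -> is_series v lv -> is_series (alternate u v) (lu + lv).
Proof.
move=> Hu Hv.
(* [is_pseries_odd_even] is about power series, so it is used at the point 1. *)
have H : is_pseries (alternate u v) 1 (lu + 1 * lv).
  apply: is_pseries_odd_even; apply/is_pseries_R.
    apply: (is_series_eq _ _ _ Hu) => j; rewrite !pow1 /alternate.
    by rewrite (_ : (2 * j)%coq_nat = j.*2) ?odd_double ?doubleK ?Rmult_1_r // -mul2n.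
  apply: (is_series_eq _ _ _ Hv) => j; rewrite !pow1 /alternate.
  rewrite (_ : (2 * j + 1)%coq_nat = j.*2.+1); last first.
    by rewrite mul2n plusE addn1.
  by rewrite /= odd_double /= uphalf_double Rmult_1_r.
rewrite -[lv]Rmult_1_l; move/is_pseries_R: H => H; apply: (is_series_eq _ _ _ H) => n.
by rewrite pow1 Rmult_1_r.
Qed.

Definition cis (t : R) : C := (cos t, sin t).

Lemma is_series_C (u : nat -> C) (l : C) :
  is_series (fun n => fst (u n)) (fst l) -> is_series (fun n => snd (u n)) (snd l) ->
  is_series u l.
Proof.
move=> H1 H2.
have E n : sum_n u n = (sum_n (fun n => fst (u n)) n, sum_n (fun n => snd (u n)) n).
  elim: n => [|n IH]; first by rewrite !sum_O; case: (u 0%N).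
  by rewrite !sum_Sn IH; case: (u n.+1).
apply: (filterlim_ext (fun n => (sum_n (fun n => fst (u n)) n, sum_n (fun n => snd (u n)) n))).
  by [].
apply/filterlim_locally => eps.
have /filterlim_locally/(_ eps) F1 := H1; have /filterlim_locally/(_ eps) F2 := H2.
by apply: filter_imp (filter_and _ _ F1 F2) => n [B1 B2]; split.
Qed.

Lemma pow_CiR (t : R) n : pow_n (Ci * t)%C n
   = alternate (fun j => ((- t ^ 2) ^ j, 0) : C) (fun j => (0, t * (- t ^ 2) ^ j) : C) n.
Proof.
rewrite /alternate; elim: n => [|n IH]; first by [].
rewrite -[pow_n _ _]/(Cmult (Ci * t)%C (pow_n (Ci * t)%C n)) IH /= uphalf_half.
by case: (odd n); rewrite ?add0n ?add1n /Cmult /=; congr (_, _); ring.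
Qed.

Lemma is_series_cis t :
  is_series (fun n => (pow_n (Ci * RtoC t) n / INR (Factorial.fact n))%C) (cis t).
Proof.
have C0 : is_series (fun _ : nat => 0) 0.
  rewrite -(Rmult_0_l (PSeries cos_n 0)).
  apply: (is_series_eq _ _ _ (is_series_scalR 0 _ _ (is_series_PSeries _ 0 CV_radius_cos_n))).
  by move=> n; ring.
have Hc := is_series_PSeries _ (t ^ 2) CV_radius_cos_n.
have Hs := is_series_scalR t _ _ (is_series_PSeries _ (t ^ 2) CV_radius_sin_n).
have Fr n : (/ RtoC (INR (Factorial.fact n)))%C = RtoC (/ INR (Factorial.fact n)).
  by rewrite RtoC_inv //; apply: INR_fact_neq_0.
apply: is_series_C.
  rewrite -[fst (cis t)]/(cos t) -[cos t]Rplus_0_r cosE.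
  apply: (is_series_eq _ _ _ (is_series_alternate _ _ _ _ Hc C0)) => n.
  rewrite pow_CiR /alternate /Cdiv Fr.
  move: (odd_double_half n); case: (odd n); rewrite ?add0n -mul2n => E.
    by set f := / INR _; rewrite /Cmult /=; ring.
  rewrite /cos_n (E : Nat.mul 2 n./2 = n) /Rdiv; set f := / INR _.
  by rewrite (opp_pow (t ^ 2)) /Cmult /=; ring.
rewrite -[snd (cis t)]/(sin t) -[sin t]Rplus_0_l sinE.
apply: (is_series_eq _ _ _ (is_series_alternate _ _ _ _ C0 Hs)) => n.
rewrite pow_CiR /alternate /Cdiv Fr.
move: (odd_double_half n); case: (odd n); rewrite ?add1n -mul2n => E; last first.
  by set f := / INR _; rewrite /Cmult /=; ring.
have {}E : Nat.add (Nat.mul 2 n./2) 1 = n by rewrite plusE addn1.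
rewrite /sin_n E /Rdiv; set f := / INR _.
by rewrite (opp_pow (t ^ 2)) /Cmult /=; ring.
Qed.

(** * The action of Gamma *)

(* The variables of a [poly2] stand for [b = a - (x,y)] and [rho = |x|^2 |y|^2];
   [rho] has to be a variable since it moves under the partial derivatives in [Gamma]. *)
Inductive poly2 : Type :=
  | PConst of R | PVar | PRho | PAdd of poly2 & poly2 | PMul of poly2 & poly2.

Fixpoint peval (p : poly2) (b rho : R) : R :=
  match p with
  | PConst r => r
  | PVar => b
  | PRho => rho
  | PAdd p q => peval p b rho + peval q b rho
  | PMul p q => peval p b rho * peval q b rho
  end.

Fixpoint pderb (p : poly2) : poly2 :=
  match p with
  | PConst _ | PRho => PConst 0
  | PVar => PConst 1
  | PAdd p q => PAdd (pderb p) (pderb q)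
  | PMul p q => PAdd (PMul (pderb p) q) (PMul p (pderb q))
  end.

Fixpoint pderrho (p : poly2) : poly2 :=
  match p with
  | PConst _ | PVar => PConst 0
  | PRho => PConst 1
  | PAdd p q => PAdd (pderrho p) (pderrho q)
  | PMul p q => PAdd (PMul (pderrho p) q) (PMul p (pderrho q))
  end.

Lemma is_derive_peval p (f g : R -> R) (t df dg : R) :
  is_derive f t df -> is_derive g t dg ->
  is_derive (fun u => peval p (f u) (g u)) t
    (peval (pderb p) (f t) (g t) * df + peval (pderrho p) (f t) (g t) * dg).
Proof.
move=> Hf Hg; elim: p => [r|||p Hp q Hq|p Hp q Hq] /=.
- by apply: (is_derive_eq _ _ _ _ _ (is_derive_const r t)) => //; rewrite /zero /=; ring.
- by apply: (is_derive_eq _ _ _ _ _ Hf) => //; ring.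
- by apply: (is_derive_eq _ _ _ _ _ Hg) => //; ring.
- apply: (is_derive_eq _ _ _ _ _ (is_derive_plus _ _ _ _ _ Hp Hq)) => //.
  by rewrite /plus /=; ring.
- by apply: (is_derive_eq _ _ _ _ _ (is_derive_mulR _ _ _ _ _ Hp Hq)) => //; ring.
Qed.

Lemma jet_peval p rho : jet (fun n b => peval (iter n pderb p) b rho).
Proof.
move=> n b; have H := is_derive_peval (iter n pderb p) _ _ b _ _
  (is_derive_idR b) (is_derive_const rho b).
by apply: (is_derive_eq _ _ _ _ _ H) => //; rewrite /zero /=; ring.
Qed.

Section GammaPoly.
Context {m : nat}.
Variable x : 'I_m -> R.
Implicit Types (z : 'I_m -> R) (k : 'I_m) (A : {set 'I_m}).

Definition poly_field (P Q : poly2) (z : 'I_m -> R) : Cl m :=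
  cladd (clscal (peval P (- inner x z) (norm2 x * norm2 z)) cl1)
        (clscal (peval Q (- inner x z) (norm2 x * norm2 z)) (bivec x z)).

Lemma sum_shift z k t (h : 'I_m -> R -> R) :
  \big[Rplus/0]_i h i (shift z k t i)
  = \big[Rplus/0]_i h i (z i) + (h k (z k + t) - h k (z k)).
Proof.
rewrite (bigD1 k) //= [in RHS](bigD1 k) //= /shift eqxx.
rewrite (eq_bigr (fun i => h i (z i))) => [|i /negbTE -> //].
by set s := bigop _ _ _; ring.
Qed.

Lemma inner_shift z k t : inner x (shift z k t) = inner x z + t * x k.
Proof. by rewrite /inner (sum_shift _ _ _ (fun i c => x i * c)) /=; ring. Qed.

Lemma norm2_shift z k t : norm2 (shift z k t) = norm2 z + (2 * t * z k + t ^ 2).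
Proof. by rewrite /norm2 /inner (sum_shift _ _ _ (fun i c => c * c)) /=; ring. Qed.

Lemma vec_shift z k t : vec (shift z k t) = cladd (vec z) (clscal t (gen k)).
Proof.
apply: functional_extensionality => A; rewrite /vec [RHS]/cladd !clsumE.
by rewrite (sum_shift _ _ _ (fun i c => clscal c (gen i) A)) /clscal /=; ring.
Qed.

Definition bivec_gen k : Cl m :=
  cladd (clopp (clmul (gen k) (vec x))) (clscal (- x k) cl1).

Lemma bivec_shift z k t : bivec x (shift z k t) = cladd (bivec x z) (clscal t (bivec_gen k)).
Proof.
by rewrite /bivec /bivec_gen vec_shift clmulDl clmulZl inner_shift; clring.
Qed.

Lemma pderiv_poly_field P Q k z :
  let ev p := peval p (- inner x z) (norm2 x * norm2 z) in
  let D p := ev (pderb p) * - x k + ev (pderrho p) * (2 * norm2 x * z k) in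
  pderiv k (poly_field P Q) z
  = cladd (cladd (clscal (D P) cl1) (clscal (D Q) (bivec x z))) (clscal (ev Q) (bivec_gen k)).
Proof.
move=> ev D; apply: functional_extensionality => A; apply: is_derive_unique.
have shift0 : shift z k 0 = z.
  by apply: functional_extensionality => i; rewrite /shift Rplus_0_r; case: ifP.
have Hs : is_derive (fun t => - inner x (shift z k t)) 0 (- x k).
  apply: (is_derive_ext (fun t => - (inner x z + t * x k))) => [t|].
    by rewrite inner_shift.
  by auto_derive => //; ring.
have Hr : is_derive (fun t => norm2 x * norm2 (shift z k t)) 0 (2 * norm2 x * z k).
  apply: (is_derive_ext (fun t => norm2 x * (norm2 z + (2 * t * z k + t ^ 2)))) => [t|].
    by rewrite norm2_shift.
  by auto_derive => //; ring.
have Hw : is_derive (fun t => bivec x (shift z k t) A) 0 (bivec_gen k A).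
  apply: (is_derive_ext (fun t => bivec x z A + t * bivec_gen k A)) => [t|].
    by rewrite bivec_shift.
  by auto_derive => //; ring.
have HP := is_derive_mulR _ _ _ _ _ (is_derive_peval P _ _ _ _ _ Hs Hr) (is_derive_const (cl1 A) 0).
have HQ := is_derive_mulR _ _ _ _ _ (is_derive_peval Q _ _ _ _ _ Hs Hr) Hw.
apply: (is_derive_eq _ _ _ _ _ (is_derive_plus _ _ _ _ _ HP HQ)) => //.
by rewrite shift0 /plus /zero /= /D /ev /cladd /clscal; ring.
Qed.

(** Derivatives in [rho] drop out, their coefficient being [z j * z k - z k * z j]. Derivatives in
    [b] assemble to a multiple of the bivector by [bivec_pairs], and [bivec_sqr] closes the product.
    Differentiating the bivector itself is [bivec_gen_pairs]. *)
Lemma Gamma_poly_field P Q z :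
  let b := - inner x z in let rho := norm2 x * norm2 z in
  Gamma (poly_field P Q) z
  = cladd (clscal (- (INR m - 1) * b * peval Q b rho
                   + (rho - b ^ 2) * peval (pderb Q) b rho) cl1)
          (clscal (- peval (pderb P) b rho + (INR m - 2) * peval Q b rho) (bivec x z)).
Proof.
move=> b rho; set U := cladd (clscal (- peval (pderb P) b rho) cl1)
                             (clscal (- peval (pderb Q) b rho) (bivec x z)).
have E j k : clmul (clmul (gen j) (gen k))
    (cladd (clscal (z j) (pderiv k (poly_field P Q) z))
           (clscal (- z k) (pderiv j (poly_field P Q) z)))
  = cladd (clmul (clscal (z j * x k - z k * x j) (clmul (gen j) (gen k))) U)
      (clscal (peval Q b rho) (clmul (clmul (gen j) (gen k))
         (cladd (clscal (z j) (bivec_gen k)) (clscal (- z k) (bivec_gen j))))).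
  rewrite clmulZl -clmulZr -clmulZr -clmulDr; congr clmul.
  by rewrite !pderiv_poly_field /U -/b -/rho; clring.
apply: functional_extensionality => A; rewrite /Gamma.
under eq_bigr => j _ do under eq_bigr => k _ do rewrite E.
transitivity (- (clmul (clopp (bivec x z)) U A + peval Q b rho *
    cladd (clscal (- (INR m - 2)) (bivec x z)) (clscal (- (INR m - 1) * inner x z) cl1) A)).
  rewrite -bivec_pairs -bivec_gen_pairs clmul_suml [in LHS]/clopp !clsumE big_distrr -big_split.
  congr (- _); apply: eq_bigr => j _; rewrite clmul_suml !clsumE /= big_distrr -big_split.
  by [].
rewrite clmulNl /U clmulDr !clmulZr clmul1r bivec_sqr.
by rewrite /clopp /cladd /clscal /b /rho; ring.
Qed.

End GammaPoly.

Lemma jet_uniq d d' n b : jet d -> jet d' -> (forall t, d 0%N t = d' 0%N t) -> d n b = d' n b.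
Proof.
by move=> dP dP' E; rewrite -(jet_Derive_n d) // -(jet_Derive_n d') //; apply: Derive_n_ext.
Qed.

Lemma jet_plus d d' : jet d -> jet d' -> jet (fun n b => d n b + d' n b).
Proof. by move=> dP dP' n b; apply: is_derive_plus. Qed.

Lemma jet_scal c d : jet d -> jet (fun n b => c * d n b).
Proof. by move=> dP n b; apply: is_derive_scal. Qed.

Lemma jet_zero : jet (fun _ _ => 0).
Proof. by move=> n b; apply: is_derive_const. Qed.

Lemma jet_sum I (r : seq I) (d : I -> nat -> R -> R) :
  (forall i, jet (d i)) -> jet (fun n b => \big[Rplus/0]_(i <- r) d i n b).
Proof.
move=> dP; elim: r => [|i r IH] n b.
  apply: (is_derive_eq _ _ _ _ _ (jet_zero n b)) => [u|]; by rewrite big_nil.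
apply: (is_derive_eq _ _ _ _ _ (jet_plus _ _ (dP i) IH n b)) => [u|]; by rewrite big_cons.
Qed.

Lemma jet_succ d : jet d -> jet (fun n => d n.+1).
Proof. by move=> dP n b; apply: dP. Qed.

(** * Eigenvectors of Gamma *)

(* A word [s] encodes the product of one factor [(s + w)/2] per [true] and one factor
   [(s - w)/2] per [false], expanded with [s = -b] and [w^2 = b^2 - rho] as
   [(eigpoly s).1 + (eigpoly s).2 * w]; summing over all words of length [N]
   gives [s^N]. *)
Definition eps (e : bool) : R := if e then 1 else -1.

Definition eigval : bitseq -> R := foldr (fun e r => r + eps e) 0.
(** Under [exp (i pi/2 D_2)] a factor [s + w] gains the phase [i] and [s - w] the phase [-i]; this
    is the product of these phases divided by [i^N], where [N] is the length of the word. *)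
Definition wsign : bitseq -> R := foldr (fun e r => eps e * r) 1.

Definition ptau : poly2 := PAdd PRho (PMul (PConst (-1)) (PMul PVar PVar)).

Fixpoint eigpoly (s : bitseq) : poly2 * poly2 :=
  match s with
  | [::] => (PConst 1, PConst 0)
  | e :: s' => let: (p, q) := eigpoly s' in
      (PAdd (PMul (PConst (-1 / 2)) (PMul PVar p)) (PMul (PConst (- eps e / 2)) (PMul ptau q)),
       PAdd (PMul (PConst (-1 / 2)) (PMul PVar q)) (PMul (PConst (eps e / 2)) p))
  end.

Fixpoint words (N : nat) : seq bitseq :=
  if N is N'.+1 then [seq true :: s | s <- words N'] ++ [seq false :: s | s <- words N']
  else [:: [::]].

Lemma words_size N s : s \in words N -> size s = N.
Proof.
elim: N s => [|N IH] s /=; first by rewrite inE => /eqP ->.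
by rewrite mem_cat => /orP[] /mapP[s' /IH <- ->].
Qed.

(* The eigenvector equation of [Gamma] in dimension 2 for [p + q w], with [b = - (x,y)]. *)
Definition eigen2 (lam : R) (p q : poly2) := forall b rho,
  lam * peval p b rho = - b * peval q b rho + (rho - b ^ 2) * peval (pderb q) b rho
  /\ lam * peval q b rho = - peval (pderb p) b rho.

Lemma eigpolyP s : eigen2 (eigval s) (eigpoly s).1 (eigpoly s).2.
Proof.
elim: s => [|e s IH] b rho; first by rewrite /=; split; ring.
move: IH => /(_ b rho) /=; case: (eigpoly s) => p q /=.
set P := peval p b rho; set Q := peval q b rho; set P' := peval (pderb p) b rho.
set Q' := peval (pderb q) b rho; set l := eigval s => -[H1 H2].
have {H2} H2 : P' = - (l * Q) by lra.
have ee : eps e * eps e = 1 by case: e => /=; ring.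
rewrite H2; split.
  (* The intermediate form isolates [l * P] and the square of [eps e], so that [H1] and [ee] can be
     rewritten. *)
  transitivity (- b / 2 * (l * P) - eps e / 2 * (rho - b ^ 2) * l * Q - eps e * b / 2 * P
     - (eps e * eps e) / 2 * (rho - b ^ 2) * Q); first by field.
  by rewrite H1 ee; field.
transitivity (- b / 2 * l * Q + eps e / 2 * (l * P) - eps e * b / 2 * Q
     + (eps e * eps e) / 2 * P); first by field.
by rewrite H1 ee; field.
Qed.

Lemma sum_words N (f : bitseq -> R) :
  \big[Rplus/0]_(s <- words N.+1) f s
  = \big[Rplus/0]_(s <- words N) (f (true :: s) + f (false :: s)).
Proof. by rewrite big_cat !big_map big_split. Qed.

Lemma sum_eigpoly N b rho :
  \big[Rplus/0]_(s <- words N) peval (eigpoly s).1 b rho = (- b) ^ N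
  /\ \big[Rplus/0]_(s <- words N) peval (eigpoly s).2 b rho = 0.
Proof.
elim: N => [|N [IH1 IH2]]; first by rewrite !big_seq1.
rewrite !sum_words; split.
  rewrite -[RHS]/(- b * (- b) ^ N) -IH1 big_distrr; apply: eq_bigr => s _ /=.
  by case: (eigpoly s) => p q /=; field.
transitivity (- b * \big[Rplus/0]_(s <- words N) peval (eigpoly s).2 b rho).
  rewrite big_distrr; apply: eq_bigr => s _ /=.
  by case: (eigpoly s) => p q /=; field.
by rewrite IH2; ring.
Qed.

(** With the signs, the sum over words multiplies out [((s + w)/2 - (s - w)/2)^N = w^N], where
    [w^2 = -(rho - b^2)]. *)
Lemma sum_wsign_eigpoly N b rho :
  \big[Rplus/0]_(s <- words N) (wsign s * peval (eigpoly s).1 b rho)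
    = alternate (fun j => (- (rho - b ^ 2)) ^ j) (fun _ => 0) N
  /\ \big[Rplus/0]_(s <- words N) (wsign s * peval (eigpoly s).2 b rho)
    = alternate (fun _ => 0) (fun j => (- (rho - b ^ 2)) ^ j) N.
Proof.
elim: N => [|N [IH1 IH2]]; first by rewrite !big_seq1 /alternate /=; split; ring.
rewrite !sum_words; split.
  transitivity (- (rho - b ^ 2) *
    \big[Rplus/0]_(s <- words N) (wsign s * peval (eigpoly s).2 b rho)).
    rewrite big_distrr; apply: eq_bigr => s _ /=.
    by case: (eigpoly s) => p q /=; field.
  rewrite IH2 /alternate /= uphalf_half; case: (odd N); rewrite ?add1n ?add0n /=; ring.
transitivity (\big[Rplus/0]_(s <- words N) (wsign s * peval (eigpoly s).1 b rho)).
  by apply: eq_bigr => s _ /=; case: (eigpoly s) => p q /=; field.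
by rewrite IH1 /alternate /= uphalf_half; case: (odd N).
Qed.

Lemma pow_CiS z n : pow_n z n.+1 = (z * pow_n z n)%C.
Proof. by []. Qed.

Lemma cis_addPI2 t : cis (t + PI / 2) = (Ci * cis t)%C.
Proof.
by rewrite /cis cos_plus sin_plus cos_PI2 sin_PI2 /Cmult /=; congr (_, _); ring.
Qed.

Lemma cis_subPI2 t : cis (t - PI / 2) = (- Ci * cis t)%C.
Proof.
by rewrite /cis cos_minus sin_minus cos_PI2 sin_PI2 /Cmult /=; congr (_, _); ring.
Qed.

Lemma Ci_sqr : (Ci * Ci = - RtoC 1)%C.
Proof. by rewrite /Cmult /= /Copp /=; congr (_, _); ring. Qed.

(** Each letter brings a phase [i] or [-i], and one factor [-i] turns it into [eps]. *)
Lemma cis_eigval s : (pow_n (- Ci) (size s) * cis (PI / 2 * eigval s))%C = RtoC (wsign s).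
Proof.
elim: s => [|e s IH].
  by rewrite /= Rmult_0_r /cis cos_0 sin_0; apply: Cmult_1_l.
rewrite [size _]/= pow_CiS [wsign _]/= RtoC_mult -IH.
case: e; rewrite [eigval _]/= [eps _]/=.
  rewrite (_ : _ * (_ + _) = PI / 2 * eigval s + PI / 2) ?cis_addPI2; last by ring.
  have aux (u v : C) : (- Ci * u * (Ci * v) = RtoC 1 * (u * v))%C by ring [Ci_sqr].
  exact: aux.
rewrite (_ : _ * (_ + _) = PI / 2 * eigval s - PI / 2) ?cis_subPI2; last by ring.
have aux (u v : C) : (- Ci * u * (- Ci * v) = - RtoC 1 * (u * v))%C by ring [Ci_sqr].
by rewrite RtoC_opp; exact: aux.
Qed.

Lemma cis_addn t n : cis (PI / 2 * (t + INR n)) = (pow_n Ci n * cis (PI / 2 * t))%C.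
Proof.
elim: n => [|n IH]; first by rewrite /= Rplus_0_r; symmetry; apply: Cmult_1_l.
rewrite pow_CiS S_INR (_ : _ * _ = PI / 2 * (t + INR n) + PI / 2) ?cis_addPI2; last by ring.
by rewrite IH; apply: Cmult_assoc.
Qed.

(* The two components of the [n]-th derivative of [p b + q b * (w + a)] in [a], at [a = 0]. *)
Definition TP n (p q : poly2) : poly2 :=
  PAdd (iter n pderb p) (PMul (PConst (INR n)) (iter n.-1 pderb q)).
Definition TQ n (q : poly2) : poly2 := iter n pderb q.

(** This is [D_m T = T (D_2 + n)] on an eigenvector: the left sides are the coefficients in
    [Gamma_poly_field] for [m = 2n + 2]. Both equations come from differentiating those of [eigen2]
    in [b]. *)
Lemma eigen_T n lam p q b rho : eigen2 lam p q ->
  - (2 * INR n + 1) * b * peval (TQ n q) b rho + (rho - b ^ 2) * peval (pderb (TQ n q)) b rho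
    = (lam + INR n) * peval (TP n p q) b rho
  /\ - peval (pderb (TP n p q)) b rho + 2 * INR n * peval (TQ n q) b rho
    = (lam + INR n) * peval (TQ n q) b rho.
Proof.
move=> pq.
pose dp n b := peval (iter n pderb p) b rho; pose dq n b := peval (iter n pderb q) b rho.
have jp : jet dp by apply: jet_peval.
have jq : jet dq by apply: jet_peval.
have E1 k : lam * dq k b = -1 * dp k.+1 b.
  apply: (jet_uniq (fun k b => lam * dq k b) (fun k b => -1 * dp k.+1 b)).
  - exact: jet_scal.
  - by apply/jet_scal/jet_succ.
  - by move=> t; have [_ H] := pq t rho; rewrite /dp /dq [LHS]H /=; ring.
(* The nested [mulb_jet] is the Leibniz rule for the factor [b^2]. *)
have E2 : lam * dp n b = -1 * mulb_jet dq n b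
     + (rho * dq n.+1 b + -1 * mulb_jet (mulb_jet (fun n => dq n.+1)) n b).
  apply: (jet_uniq (fun k b => lam * dp k b) (fun n b => -1 * mulb_jet dq n b
     + (rho * dq n.+1 b + -1 * mulb_jet (mulb_jet (fun n => dq n.+1)) n b))).
  - exact: jet_scal.
  - apply: jet_plus; first by apply/jet_scal/jet_mulb.
    apply: jet_plus; first by apply/jet_scal/jet_succ.
    by apply/jet_scal/jet_mulb/jet_mulb/jet_succ.
  - by move=> t; have [H _] := pq t rho; rewrite /dp /dq [LHS]H /mulb_jet /=; ring.
rewrite /TP /TQ /= -!iterS -!/(dp _ b) -!/(dq _ b).
have E1n := E1 n.
(* This is [E1] at [n - 1]; the factor [INR n] covers [n = 0], where the predecessor is a default
   value. *)
have E1p : INR n * dp n b = - lam * (INR n * dq n.-1 b).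
  case: (n) E1 => [|k] E1; first by rewrite /=; ring.
  have := E1 k; rewrite [_.-1]/= => H.
  by rewrite -Rmult_assoc (Rmult_comm _ (INR _)) Rmult_assoc; nra.
have Eq : INR n * dq n.-1.+1 b = INR n * dq n b by case: (n) => [|k] //=; ring.
split; last by nra.
move: E2; rewrite /mulb_jet.
(* The indices differ only for [n] at most 1, where the coefficient is 0. *)
have -> : INR (Nat.pred n) * dq (Nat.pred (Nat.pred n)).+1 b
  = INR (Nat.pred n) * dq (Nat.pred n) b.
  by case: (n) => [|[|k]] //=; ring.
rewrite Rmult_plus_distr_l -[X in b * (_ + X)]/(INR n * _) Eq.
have En : INR n * INR (Nat.pred n) = INR n * (INR n - 1).
  by case: (n) => [|k]; rewrite ?S_INR /=; ring.
(* [E2] is the first equation of [pq] differentiated [n] times. *)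
have T1 : INR n * (b * dq n.-1.+1 b) = b * (INR n * dq n b) by rewrite -Eq; ring.
have T2 : INR n * (INR n.-1 * dq n.-1 b) = INR n * (INR n - 1) * dq n.-1 b by rewrite -En; ring.
by rewrite (Rmult_plus_distr_l (INR n)) T1 T2 => E2; nra.
Qed.

(** * Iterates of [Gamma] on combinations of eigenvectors *)

Fixpoint psum (r : seq bitseq) (c : bitseq -> R) (f : bitseq -> poly2) : poly2 :=
  if r is s :: r' then PAdd (PMul (PConst (c s)) (f s)) (psum r' c f) else PConst 0.

Lemma peval_psum r c f b rho :
  peval (psum r c f) b rho = \big[Rplus/0]_(s <- r) (c s * peval (f s) b rho).
Proof. by elim: r => [|s r IH] /=; rewrite ?big_nil ?big_cons ?IH. Qed.

Lemma peval_pderb_psum r c f b rho :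
  peval (pderb (psum r c f)) b rho = \big[Rplus/0]_(s <- r) (c s * peval (pderb (f s)) b rho).
Proof.
by elim: r => [|s r IH] /=; rewrite ?big_nil ?big_cons ?IH //; ring.
Qed.

Lemma poly_field_ext {m} (x : 'I_m -> R) P Q P' Q' :
  (forall b rho, peval P b rho = peval P' b rho) ->
  (forall b rho, peval Q b rho = peval Q' b rho) ->
  poly_field x P Q = poly_field x P' Q'.
Proof.
by move=> EP EQ; apply: functional_extensionality => z; rewrite /poly_field EP EQ.
Qed.

Definition wordTP n s := TP n (eigpoly s).1 (eigpoly s).2.
Definition wordTQ n s := TQ n (eigpoly s).2.

Lemma eigen_word n s b rho :
  - (2 * INR n + 1) * b * peval (wordTQ n s) b rho
    + (rho - b ^ 2) * peval (pderb (wordTQ n s)) b rho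
    = (eigval s + INR n) * peval (wordTP n s) b rho
  /\ - peval (pderb (wordTP n s)) b rho + 2 * INR n * peval (wordTQ n s) b rho
    = (eigval s + INR n) * peval (wordTQ n s) b rho.
Proof. exact/eigen_T/eigpolyP. Qed.

Lemma Gamma_words {m} (x : 'I_m -> R) n r (c : bitseq -> R) :
  INR m = 2 * INR n + 2 ->
  Gamma (poly_field x (psum r c (wordTP n)) (psum r c (wordTQ n)))
  = poly_field x (psum r (fun s => c s * (eigval s + INR n)) (wordTP n))
                 (psum r (fun s => c s * (eigval s + INR n)) (wordTQ n)).
Proof.
move=> mn; apply: functional_extensionality => z.
rewrite Gamma_poly_field /poly_field !peval_psum !peval_pderb_psum mn.
move: (- inner x z) (norm2 x * norm2 z) => b rho.
congr cladd; congr clscal.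
  rewrite !big_distrr -big_split; apply: eq_bigr => s _.
  have [+ _] := eigen_word n s b rho.
  set P := peval (wordTP n s) b rho; set Q := peval (wordTQ n s) b rho.
  set Q' := peval (pderb _) b rho => /= H.
  by rewrite [RHS]Rmult_assoc -H; ring.
rewrite (big_morph Ropp Ropp_plus_distr Ropp_0) !big_distrr -big_split; apply: eq_bigr => s _.
have [_] := eigen_word n s b rho; set Q := peval (wordTQ n s) b rho.
set P' := peval (pderb _) b rho => /= H.
by rewrite [RHS]Rmult_assoc -H; ring.
Qed.

Lemma pow_jet_addn k n t :
  INR (Factorial.fact k) * pow_jet (k + n) n t = INR (Factorial.fact (k + n)) * t ^ k.
Proof.
elim: n => [|n IH]; first by rewrite addn0.
have -> : INR (Factorial.fact (k + n.+1)) = INR (k + n).+1 * INR (Factorial.fact (k + n)).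
  by rewrite addnS -mult_INR.
rewrite Rmult_assoc -IH addnS -[pow_jet _ _ _]/(INR (k + n).+1 * pow_jet (k + n) n t).
by set f := INR (Factorial.fact k); ring.
Qed.

Lemma jet_powN N : jet (fun n b => (-1) ^ n * pow_jet N n (- b)).
Proof.
move=> n b; apply: (is_derive_eq _ _ _ _ _ (is_derive_scal _ b ((-1) ^ n) _
  (is_derive_comp (pow_jet N n) Ropp b _ _ (jet_pow N n _)
    (is_derive_opp _ _ _ (is_derive_idR b))))).
  by [].
by rewrite /scal /opp /= /mult /=; ring.
Qed.

Lemma jet_words N rho (f : bitseq -> poly2) (w : bitseq -> R) d n b : jet d ->
  (forall t, \big[Rplus/0]_(s <- words N) (w s * peval (f s) t rho) = d 0%N t) ->
  \big[Rplus/0]_(s <- words N) (w s * peval (iter n pderb (f s)) b rho) = d n b.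
Proof.
move=> jd E.
apply: (jet_uniq (fun n b => \big[Rplus/0]_(s <- words N)
   (w s * peval (iter n pderb (f s)) b rho))) => //.
by apply: jet_sum => s; apply: jet_scal; apply: jet_peval.
Qed.

(** [T] is linear, so it can be applied after the summation over words, where closed forms [d] and
    [d'] are known. *)
Lemma sum_wordTP N n (w : bitseq -> R) rho d d' b : jet d -> jet d' ->
  (forall t, \big[Rplus/0]_(s <- words N) (w s * peval (eigpoly s).1 t rho) = d 0%N t) ->
  (forall t, \big[Rplus/0]_(s <- words N) (w s * peval (eigpoly s).2 t rho) = d' 0%N t) ->
  \big[Rplus/0]_(s <- words N) (w s * peval (wordTP n s) b rho) = d n b + INR n * d' n.-1 b
  /\ \big[Rplus/0]_(s <- words N) (w s * peval (wordTQ n s) b rho) = d' n b.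
Proof.
move=> jd jd' E E'; split; last exact: (jet_words _ _ (fun s => (eigpoly s).2)).
rewrite -(jet_words _ rho (fun s => (eigpoly s).1) w _ n b jd E).
rewrite -(jet_words _ rho (fun s => (eigpoly s).2) w _ n.-1 b jd' E').
rewrite big_distrr -big_split; apply: eq_bigr => s _ /=.
by ring.
Qed.

(** The factorials undo the constant of [pow_jet_addn], the sign undoes [n] derivatives of a power
    of [-b], and each application of [Gamma] contributes one eigenvalue. *)
Definition word_coef n k j s : R :=
  (-1) ^ n * (INR (Factorial.fact k) / INR (Factorial.fact (k + n))) * (eigval s + INR n) ^ j.

Lemma iter_Gamma {m} (x : 'I_m -> R) n k j : INR m = 2 * INR n + 2 ->
  Nat.iter j (@Gamma m) (fun z => clscal (inner x z ^ k) cl1)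
  = poly_field x (psum (words (k + n)) (word_coef n k j) (wordTP n))
                 (psum (words (k + n)) (word_coef n k j) (wordTQ n)).
Proof.
move=> mn; elim: j => [|j IH].
  apply: functional_extensionality => z; rewrite [LHS]/= /poly_field !peval_psum.
  set b := - inner x z; set rho := norm2 x * norm2 z.
  have [] := sum_wordTP (k + n) n (fun _ => 1) rho
     (fun l b => (-1) ^ l * pow_jet (k + n) l (- b)) (fun _ _ => 0) b
     (jet_powN _) jet_zero _ _.
  - move=> t; have [H _] := sum_eigpoly (k + n) t rho.
    rewrite Rmult_1_l -[RHS]H; apply: eq_bigr => s _; exact: Rmult_1_l.
  - move=> t; have [_ H] := sum_eigpoly (k + n) t rho.
    rewrite -[RHS]H; apply: eq_bigr => s _; exact: Rmult_1_l.
  have D f : \big[Rplus/0]_(s <- words (k + n)) (word_coef n k 0 s * peval (f s) b rho)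
    = (-1) ^ n * (INR (Factorial.fact k) / INR (Factorial.fact (k + n))) *
      \big[Rplus/0]_(s <- words (k + n)) (1 * peval (f s) b rho).
    by rewrite big_distrr; apply: eq_bigr => s _; rewrite /word_coef /=; ring.
  rewrite !D => -> ->; rewrite Ropp_involutive.
  have F := pow_jet_addn k n (inner x z).
  have F0 := INR_fact_neq_0 (k + n).
  have S : (-1) ^ n * (-1) ^ n = 1.
    by rewrite -Rpow_mult_distr (_ : -1 * -1 = 1) ?pow1 //; ring.
  have -> : (-1) ^ n * (INR (Factorial.fact k) / INR (Factorial.fact (k + n))) *
      ((-1) ^ n * pow_jet (k + n) n (inner x z) + INR n * 0) = inner x z ^ k.
    transitivity (((-1) ^ n * (-1) ^ n) *
      (INR (Factorial.fact k) * pow_jet (k + n) n (inner x z)) / INR (Factorial.fact (k + n))).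
      by field.
    by rewrite S F; field.
  by clring.
rewrite [LHS]/= IH Gamma_words //; apply: poly_field_ext => b rho;
  rewrite !peval_psum; apply: eq_bigr => s _; rewrite /word_coef /=; ring.
Qed.

(** * The matrix exponential *)

Section MatrixExponential.
Context {m : nat}.
Variables (x y : 'I_m -> R) (a : R).
Let t := norm2 x * norm2 y - (inner x y - a) ^ 2.
Let M := m2opp (Amat x y a).

(** The row sums are the entries of [(-A)^n (1 1)^T]. As [A^2] is the scalar [-t], this column is a
    power of [-t] times that of [1] or of [-A]. *)
Lemma m2pow_col n i :
  cladd (m2pow M n i false) (m2pow M n i true)
  = alternate (fun j => clscal ((- t) ^ j) cl1)
              (fun j => clscal ((- t) ^ j) (cladd (M i false) (M i true))) n.
Proof.
elim: n i => [|n IH] i.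
  by rewrite /alternate /= /m2id; case: i => /=; clring.
have -> : cladd (m2pow M n.+1 i false) (m2pow M n.+1 i true)
    = cladd (clmul (M i false) (cladd (m2pow M n false false) (m2pow M n false true)))
            (clmul (M i true) (cladd (m2pow M n true false) (m2pow M n true true))).
  by rewrite /= /m2mul !clmulDr; clring.
rewrite !IH /alternate /= uphalf_half; case: (odd n); rewrite ?add1n ?add0n; last first.
  by rewrite !clmulZr !clmul1r; clring.
have -> : (- t) ^ n./2.+1 = (- t) * (- t) ^ n./2 by [].
rewrite !clmulZr; case: i; rewrite /M /m2opp /Amat !(clmulDr, clmulNl, clmulNr, clmulZl, clmulZr,
  clmul1l, clmul1r) ?clmul_yxxy; by rewrite /t; clring.
Qed.

Lemma is_series_expA A : is_series (fun n => expA_term x y a n A) (G_rhs x y a A).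
Proof.
rewrite /G_rhs -/t {1}/cladd {1 2}/clscal cos_sqrtE sinc_sqrtE.
set u := cladd (clopp _) _.
have Hc := is_series_scalR (cl1 A) _ _ (is_series_PSeries _ t CV_radius_cos_n).
have Hs := is_series_scalR (u A) _ _ (is_series_PSeries _ t CV_radius_sin_n).
rewrite (Rmult_comm _ (cl1 A)) (Rmult_comm _ (u A)).
apply: (is_series_eq _ _ _ (is_series_alternate _ _ _ _ Hc Hs)) => n.
rewrite /expA_term {1}/clscal m2pow_col /alternate.
have -> : cladd (M true false) (M true true) = u by rewrite /u /M /m2opp /Amat; clring.
move: (odd_double_half n); case: (odd n); rewrite ?add0n ?add1n -mul2n => E.
  have {}E : Nat.add (Nat.mul 2 n./2) 1 = n by rewrite plusE addn1.
  by rewrite /sin_n E /Rdiv /clscal (opp_pow t); set f := / INR _; ring.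
rewrite /cos_n (E : Nat.mul 2 n./2 = n) /Rdiv /clscal (opp_pow t); set f := / INR _; ring.
Qed.

End MatrixExponential.

(** * Summation of the kernel *)

Lemma big_RtoC I (r : seq I) (f : I -> R) :
  RtoC (\big[Rplus/0]_(i <- r) f i) = \big[Cplus/RtoC 0]_(i <- r) RtoC (f i).
Proof. exact: (big_morph RtoC RtoC_plus). Qed.

Lemma pow_n_CiM t u j : (pow_n (Ci * RtoC t) j * RtoC (u ^ j)%R = pow_n (Ci * RtoC (t * u)%R) j)%C.
Proof.
elim: j => [|j IH]; first by apply: Cmult_1_l.
have -> : u ^ j.+1 = u * u ^ j by [].
rewrite !pow_CiS -IH !RtoC_mult; set p : C := pow_n _ _; set v := RtoC (u ^ j).
have aux (c d e : C) : (c * d * p * (e * v) = c * (d * e) * (p * v))%C by ring.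
exact: aux.
Qed.

Lemma is_series_C0 : is_series (fun _ : nat => RtoC 0) (RtoC 0).
Proof.
have H := is_series_scal (RtoC 0 : C_AbsRing) _ _ (is_series_cis 0).
have E : scal (RtoC 0 : C_AbsRing) (cis 0 : C_NormedModule) = RtoC 0 by apply: Cmult_0_l.
by rewrite E in H; apply: is_series_ext H => n; apply: Cmult_0_l.
Qed.

(** The effect of [exp (i theta Gamma)] on a finite combination of eigenvectors: the series yields
    one phase per eigenvalue. *)
Lemma is_series_cis_sum I (r : seq I) (c mu : I -> R) theta (K : C) :
  is_series (fun j => (pow_n (Ci * RtoC theta) j / RtoC (INR (Factorial.fact j)) * K
                       * RtoC (\big[Rplus/0]_(i <- r) (c i * mu i ^ j)%R))%C)
            (K * \big[Cplus/RtoC 0]_(i <- r) (RtoC (c i) * cis (theta * mu i)%R))%C.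
Proof.
elim: r => [|i r IH].
  rewrite big_nil Cmult_0_r; apply: is_series_ext is_series_C0 => j.
  by rewrite big_nil; symmetry; apply: Cmult_0_r.
have H := is_series_plus _ _ _ _
  (is_series_scal (Cmult K (RtoC (c i)) : C_AbsRing) _ _ (is_series_cis (theta * mu i))) IH.
rewrite big_cons Cmult_plus_distr_l Cmult_assoc; apply: is_series_ext H => j.
cbv beta; rewrite -pow_n_CiM big_cons RtoC_plus RtoC_mult.
set p : C := pow_n _ _; set f := RtoC (INR _); set v := RtoC (mu i ^ j).
set S := RtoC (bigop _ _ _); set d := RtoC (c i).
have aux : (K * d * (p * v / f) + p / f * K * S = p / f * K * (d * v + S))%C.
  by rewrite /Cdiv; ring.
exact: aux.
Qed.

Lemma pow_nN n : (RtoC ((-1) ^ n)%R * pow_n Ci n = pow_n (- Ci) n)%C.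
Proof.
elim: n => [|n IH]; first by apply: Cmult_1_l.
have -> : (-1) ^ n.+1 = (-1) * (-1) ^ n by [].
rewrite !pow_CiS -IH RtoC_mult RtoC_opp; set p : C := pow_n _ _; set v := RtoC ((-1) ^ n).
have aux : (- RtoC 1 * v * (Ci * p) = - Ci * (v * p))%C by ring.
exact: aux.
Qed.

Lemma pow_n_addn (z : C) k n : (pow_n z k * pow_n z n = pow_n z (k + n)%N)%C.
Proof. by rewrite -plusE; symmetry; apply: pow_n_plus. Qed.

(** The shift of the eigenvalues by [n] gives [i^n], and with [(-1)^n] this completes [(-i)^k] to
    [(-i)^(k+n)], the power that [cis_eigval] absorbs for words of length [k + n]. *)
Lemma sum_words_cis k n (E : bitseq -> R) :
  (pow_n (- Ci) k / RtoC (INR (Factorial.fact k)) *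
    \big[Cplus/RtoC 0]_(s <- words (k + n))
      (RtoC ((-1) ^ n * (INR (Factorial.fact k) / INR (Factorial.fact (k + n))) * E s)%R
       * cis (PI / 2 * (eigval s + INR n))%R))%C
  = RtoC (\big[Rplus/0]_(s <- words (k + n)) (wsign s / INR (Factorial.fact (k + n)) * E s)%R).
Proof.
set K := (_ / _)%C.
rewrite (big_morph (Cmult K) (Cmult_plus_distr_l K) (Cmult_0_r K)) big_RtoC.
rewrite big_seq [RHS]big_seq; apply: eq_bigr => s /words_size sN.
have F0 := INR_fact_neq_0 k; have F1 := INR_fact_neq_0 (k + n).
rewrite cis_addn /Rdiv !RtoC_mult -cis_eigval sN -pow_n_addn -(pow_nN n) /K /Cdiv.
have Fk : (/ RtoC (INR (Factorial.fact k)) * RtoC (INR (Factorial.fact k)) = RtoC 1)%C.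
  by apply: Cinv_l => H; apply: F0; apply: RtoC_inj.
move: Fk; set f := RtoC (INR (Factorial.fact k)); set f' := Cinv f.
set g := RtoC (/ _); set e := RtoC (E s); set c := cis _; set v := RtoC ((-1) ^ n).
set p : C := pow_n _ _; set q : C := pow_n _ _ => Fk.
have aux : (p * f' * (v * (f * g) * e * (q * c)) = (p * (v * q) * c) * g * e)%C.
  transitivity (p * v * e * q * c * g * (f' * f))%C; first by ring.
  by rewrite Fk; ring.
exact: aux.
Qed.

(** * Coordinates of the kernel series *)

Definition cos_jet j l t := cos_n j * pow_jet j l t.
Definition sin_jet j l t := sin_n j * pow_jet j l t.

Section KernelSeries.
Variables (n : nat) (rho b c1 w : R).

(* [kernel_coef N] is a coordinate of [T (w^N) / N!]. *)
Definition kernel_coef : nat -> R :=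
  alternate (fun j => dtau rho (cos_jet j) n b * c1)
    (fun j => INR n * dtau rho (sin_jet j) n.-1 b * c1 + dtau rho (sin_jet j) n b * w).

Lemma jet_alternate (d d' : nat -> nat -> R -> R) N :
  (forall j, jet (d j)) -> (forall j, jet (d' j)) ->
  jet (fun l u => alternate (fun j => d j l u) (fun j => d' j l u) N).
Proof. by move=> H H'; rewrite /alternate; case: (odd N). Qed.

(** Before differentiation the sum is [w^N / N!], whose components are terms of the series [cos_n]
    or [sin_n] at [rho - b^2]; [sum_wordTP] then applies [T]. *)
Lemma sum_wsign_word N :
  \big[Rplus/0]_(s <- words N) (wsign s / INR (Factorial.fact N) *
     (peval (wordTP n s) b rho * c1 + peval (wordTQ n s) b rho * w)) = kernel_coef N.
Proof.
have jc j : jet (dtau rho (cos_jet j)) by apply/jet_dtau/jet_scal/jet_pow.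
have js j : jet (dtau rho (sin_jet j)) by apply/jet_dtau/jet_scal/jet_pow.
have D f u : \big[Rplus/0]_(s <- words N) (wsign s / INR (Factorial.fact N) * peval (f s) u rho)
  = / INR (Factorial.fact N) * \big[Rplus/0]_(s <- words N) (wsign s * peval (f s) u rho).
  by rewrite big_distrr; apply: eq_bigr => s _ /=; rewrite /Rdiv; ring.
have [] := sum_wordTP N n (fun s => wsign s / INR (Factorial.fact N)) rho
  (fun l u => alternate (fun j => dtau rho (cos_jet j) l u) (fun _ => 0) N)
  (fun l u => alternate (fun _ => 0) (fun j => dtau rho (sin_jet j) l u) N) b
  (jet_alternate _ _ _ jc (fun _ => jet_zero)) (jet_alternate _ _ _ (fun _ => jet_zero) js).
- move=> u; rewrite D; have [-> _] := sum_wsign_eigpoly N u rho; rewrite /alternate.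
  move: (odd_double_half N); case: (odd N); rewrite ?add0n -mul2n => E; first by ring.
  rewrite [RHS]/= /cos_jet /cos_n (E : Nat.mul 2 N./2 = N) opp_pow /Rdiv.
  by set f := / INR _; rewrite /=; ring.
- move=> u; rewrite D; have [_ ->] := sum_wsign_eigpoly N u rho; rewrite /alternate.
  move: (odd_double_half N); case: (odd N); rewrite ?add1n -mul2n => E; last by ring.
  have {}E : Nat.add (Nat.mul 2 N./2) 1 = N by rewrite plusE addn1.
  rewrite [RHS]/= /sin_jet /sin_n E opp_pow /Rdiv.
  by set f := / INR _; rewrite /=; ring.
move=> E1 E2.
transitivity (
    \big[Rplus/0]_(s <- words N)
      (wsign s / INR (Factorial.fact N) * peval (wordTP n s) b rho) * c1
  + \big[Rplus/0]_(s <- words N)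
      (wsign s / INR (Factorial.fact N) * peval (wordTQ n s) b rho) * w).
  by rewrite !big_distrl -big_split; apply: eq_bigr => s _ /=; ring.
rewrite E1 E2 /kernel_coef /alternate; case: (odd N); ring.
Qed.

Definition kernel_sum : R :=
  dtau rho (entire_jet cos_n) n b * c1
  + (INR n * dtau rho (entire_jet sin_n) n.-1 b * c1 + dtau rho (entire_jet sin_n) n b * w).

Lemma is_series_kernel_coef : is_series kernel_coef kernel_sum.
Proof.
have H a l : CV_radius a = p_infty ->
    is_series (fun j => dtau rho (fun l t => a j * pow_jet j l t) l b)
              (dtau rho (entire_jet a) l b).
  move=> aE; apply: (is_series_dtau rho (fun j l t => a j * pow_jet j l t)) => i.
  exact: is_series_entire.
apply: is_series_alternate.
  rewrite Rmult_comm; apply: (is_series_eq _ _ _ (is_series_scalR c1 _ _ (H _ n CV_radius_cos_n))).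
  by move=> j; rewrite Rmult_comm.
have H1 := is_series_scalR (INR n * c1) _ _ (H _ n.-1 CV_radius_sin_n).
have H2 := is_series_scalR w _ _ (H _ n CV_radius_sin_n).
have H3 := is_series_plus _ _ _ _ H1 H2.
set l := plus _ _ in H3.
have -> : INR n * dtau rho (entire_jet sin_n) n.-1 b * c1 + dtau rho (entire_jet sin_n) n b * w = l.
  by rewrite /l /plus /=; ring.
by apply: (is_series_eq _ _ _ H3) => j; rewrite /plus /= /sin_jet; ring.
Qed.

(** In [w^N] the scalar part has degree at most [N] in [b] and the coefficient of [w] at most
    [N - 1], so even its derivative of order [n - 1] vanishes. *)
Lemma kernel_coef_vanish N : (N < n)%N -> kernel_coef N = 0.
Proof.
have V a j l : (j.+1.*2 <= l.+1)%N -> dtau rho (fun l t => a j * pow_jet j l t) l b = 0.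
  by move=> jl; apply: (dtau_vanish rho _ j.+1) => // i t ji; rewrite pow_jet_vanish //; ring.
rewrite /kernel_coef /alternate => Nn; move: (odd_double_half N) Nn.
case: (odd N); rewrite ?add0n ?add1n => E; rewrite -{1}E => Nn.
  rewrite (V sin_n) ?(V sin_n) //; first by ring.
    by rewrite doubleS; apply: leqW.
  by rewrite doubleS; case: (n) Nn.
by rewrite (V cos_n) ?doubleS //; ring.
Qed.

Lemma is_series_kernel_tail : is_series (fun k => kernel_coef (k + n)) kernel_sum.
Proof.
have H := is_series_kernel_coef; have V := kernel_coef_vanish.
have S0 i : (i < n)%N -> sum_n kernel_coef i = 0.
  elim: i => [|i IH] i_n; first by rewrite sum_O V.
  by rewrite sum_Sn V // IH ?(ltnW i_n) // /plus /=; ring.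
have [n0|n0] := posnP n.
  by apply: (is_series_eq _ _ _ H) => k; rewrite n0 addn0.
apply: (is_series_eq (fun k => kernel_coef (Nat.add n k))).
  apply: is_series_incr_n; first by apply/ltP.
  rewrite S0 ?prednK //; have -> : plus kernel_sum 0 = kernel_sum by apply: Rplus_0_r.
  exact: H.
by move=> k; rewrite plusE addnC.
Qed.

End KernelSeries.

Lemma Derive_n_G_rhs {m} (x y : 'I_m -> R) n A :
  Derive_n (fun a => G_rhs x y a A) n 0
  = kernel_sum n (norm2 x * norm2 y) (- inner x y) (cl1 A) (bivec x y A).
Proof.
set rho := norm2 x * norm2 y; set V := clopp (clmul (vec y) (vec x)) A.
have jc := jet_dtau rho _ (jet_entire _ CV_radius_cos_n).
have js := jet_dtau rho _ (jet_entire _ CV_radius_sin_n).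
(* In the variable [b = a - (x,y)] the Clifford factor is [-yx + b], so only Leibniz terms in [b]
   appear; at [a = 0] it equals the bivector. *)
pose d l b := cl1 A * dtau rho (entire_jet cos_n) l b
  + (V * dtau rho (entire_jet sin_n) l b + cl1 A * mulb_jet (dtau rho (entire_jet sin_n)) l b).
have jd : jet d.
  apply: jet_plus; first exact: jet_scal.
  by apply: jet_plus; apply: jet_scal => //; apply: jet_mulb.
rewrite (Derive_n_ext _ (fun a => d 0%N (a + - inner x y))) => [|a].
  rewrite Derive_n_comp_trans jet_Derive_n // Rplus_0_l /d /kernel_sum /bivec.
  by rewrite /cladd /clscal -/V /mulb_jet; ring.
rewrite /G_rhs /cladd /clscal -/V cos_sqrtE sinc_sqrtE /d /mulb_jet /= -/rho.
rewrite /entire_jet /= (_ : inner x y - a = - (a + - inner x y)); last by ring.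
rewrite (_ : - (a + - inner x y) * _ = (a + - inner x y) * ((a + - inner x y) * 1)); last by ring.
by ring.
Qed.

Theorem theorem7 (m : nat) (hm : (2 <= m)%N) (hev : ~~ odd m) (x y : 'I_m -> R) :
  (forall (a : R) (A : {set 'I_m}),
      is_series (fun n => expA_term x y a n A) (G_rhs x y a A))
  /\ CF_kernel_is (PI / 2) x y
       (fun A => RtoC (Derive_n (fun a => G_rhs x y a A) (Nat.pred (half m)) 0)).
Proof.
split=> [a A|A]; first exact: is_series_expA.
(* [n = m/2 - 1] is the exponent of [a] belonging to dimension [m]. Since [Gamma(m/2) = n!], the
   kernel is the [n]-th derivative at 0 with no further factor. *)
set n := Nat.pred (half m).
have mn : INR m = 2 * INR n + 2.
  have E : m = n.+1.*2.
    rewrite -[LHS]odd_double_half (negbTE hev) add0n /n; congr _.*2.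
    by move: hm; rewrite -[m in (2 <= m)%N]odd_double_half (negbTE hev); case: (m./2).
  by rewrite E -addnn -plusE plus_INR S_INR; ring.
rewrite Derive_n_G_rhs.
set rho := norm2 x * norm2 y; set b := - inner x y.
(* The [k]-th inner sum is the coordinate of [T (w^N) / N!] with [N = k + n], which is real. *)
exists (fun k => RtoC (kernel_coef n rho b (cl1 A) (bivec x y A) (k + n))).
split=> [k|]; last first.
  apply: is_series_C; first exact: is_series_kernel_tail.
  have := is_series_scalR 0 _ _ (is_series_kernel_tail n rho b (cl1 A) (bivec x y A)).
  by rewrite Rmult_0_l => H; apply: (is_series_eq _ _ _ H) => k; rewrite Rmult_0_l.
pose E s := peval (wordTP n s) b rho * cl1 A + peval (wordTQ n s) b rho * bivec x y A.
rewrite -sum_wsign_word -(sum_words_cis k n E).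
apply: is_series_ext (is_series_cis_sum _ _ _ (fun s => eigval s + INR n) _ _) => j.
rewrite /kernel_term (iter_Gamma _ n k j mn); congr (_ * RtoC _)%C.
rewrite /poly_field /cladd /clscal !peval_psum -/b -/rho !big_distrl -big_split.
by apply: eq_bigr => s _; rewrite /word_coef /E /=; ring.
Qed.
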